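(* Let $q,z$ be complex numbers with $0<|q|<1$, $z\neq 0$, and $z\ne q^{m}$ for every nonzero integer $m$. Then \begin{align*} &(zq, z^{-1}q,q;q)_{\infty}R(z;q)\\ &=\sum_{n=0}^{\infty}\left(\sum_{j=0}^{[n/2]}(-1)^{n+j}z^{n-3j} q^{\frac{1}{2}(n^2-3j^2)+\frac{1}{2}(n-j)} +\sum_{j=1}^{[n/2]}(-1)^{n+j}z^{n-3j+1} q^{\frac{1}{2}(n^2-3j^2)+\frac{1}{2}(n+j)}\right)\\ &=\sum_{n=0}^{\infty}\ \sum_{0\leq j<n/3}(-1)^{n+j}(z^{n-3j}+z^{3j-n}) q^{\frac{1}{2}(n^2-3j^2)+\frac{1}{2}(n-j)} +\sum_{j=0}^{\infty}q^{3j^2+j}\\ &\quad +\sum_{n=0}^{\infty}\ \sum_{1\leq j<(n+1)/3}(-1)^{n+j}(z^{n-3j+1}+z^{3j-n-1}) q^{\frac{1}{2}(n^2-3j^2)+\frac{1}{2}(n+j)} -\sum_{j=1}^{\infty}q^{3j^2-j}. \end{align*}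
   Context: Notation: $(a;q)_\infty=\prod_{n=0}^\infty(1-aq^n)$, $(a;q)_n=\dfrac{(a;q)_\infty}{(aq^n;q)_\infty}$ (so $(a;q)_n=\prod_{i=0}^{n-1}(1-aq^i)$ for $n\ge 0$), and $(a_1,\ldots,a_k;q)_\infty=(a_1;q)_\infty\cdots(a_k;q)_\infty$. $[x]$ denotes the integer part (floor) of $x$. Empty sums are $0$. The Dyson rank function is $$R(z;q)=\sum_{n=0}^{\infty}\frac{q^{n^2}}{(zq;q)_n(z^{-1}q;q)_n}.$$ *)

(* Defs.v *)
From HB Require Import structures.
From mathcomp Require Import all_boot all_order all_algebra.
From mathcomp Require Import complex.
From mathcomp Require Import all_classical all_reals all_analysis.
Set Implicit Arguments.
Unset Strict Implicit.
Unset Printing Implicit Defensive.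
Import Order.TTheory GRing.Theory Num.Theory.
Import numFieldNormedType.Exports.
Local Open Scope classical_set_scope.
Local Open Scope ring_scope.

(* Everything is stated over a numFieldType K, which carries the topology of
   its norm; the type R[i] itself has no declared topology, but the instance
   K := R[i] gives the usual one on the complex numbers. *)

(* [infsum m u] is only meaningful together with [infsum_cvg m u]: the limit
   operator returns a default value on divergent sequences. *)
Definition psum (K : numFieldType) (m : nat) (u : nat -> K) : nat -> K :=
  fun N => \sum_(m <= n < N) u n.

Definition infsum_cvg (K : numFieldType) (m : nat) (u : nat -> K) : Prop :=
  cvgn (psum m u).

Definition infsum (K : numFieldType) (m : nat) (u : nat -> K) : K :=
  limn (psum m u).

Definition qpoch (K : numFieldType) (a q : K) (n : nat) : K :=
  \prod_(0 <= i < n) (1 - a * q ^+ i).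

Definition qpoch_inf_cvg (K : numFieldType) (a q : K) : Prop :=
  cvgn (qpoch a q).

Definition qpoch_inf (K : numFieldType) (a q : K) : K :=
  limn (qpoch a q).

Definition rank_term (K : numFieldType) (z q : K) (n : nat) : K :=
  q ^+ (n ^ 2)%N / (qpoch (z * q) q n * qpoch (z^-1 * q) q n).

Definition dyson_rank (K : numFieldType) (z q : K) : K :=
  infsum 0 (rank_term z q).

(* The dividends are n(n+1) - j(3j+1) and n(n+1) - j(3j-1), which are even:
   the integer divisions are exact. *)
Definition expo_minus (n j : nat) : int :=
  ((n%:Z ^+ 2 - 3 * j%:Z ^+ 2 + (n%:Z - j%:Z)) %/ 2)%Z.

Definition expo_plus (n j : nat) : int :=
  ((n%:Z ^+ 2 - 3 * j%:Z ^+ 2 + (n%:Z + j%:Z)) %/ 2)%Z.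

Definition hecke_term (K : numFieldType) (z q : K) (n : nat) : K :=
  \sum_(0 <= j < n./2.+1)
     (-1) ^+ (n + j) * z ^ (n%:Z - 3 * j%:Z) * q ^ expo_minus n j
  + \sum_(1 <= j < n./2.+1)
     (-1) ^+ (n + j) * z ^ (n%:Z - 3 * j%:Z + 1) * q ^ expo_plus n j.

Definition sym_term_minus (K : numFieldType) (z q : K) (n : nat) : K :=
  \sum_(0 <= j < n | (3 * j < n)%N)
     (-1) ^+ (n + j) * (z ^ (n%:Z - 3 * j%:Z) + z ^ (3 * j%:Z - n%:Z))
     * q ^ expo_minus n j.

Definition sym_term_plus (K : numFieldType) (z q : K) (n : nat) : K :=
  \sum_(1 <= j < n.+1 | (3 * j < n + 1)%N)
     (-1) ^+ (n + j) * (z ^ (n%:Z - 3 * j%:Z + 1) + z ^ (3 * j%:Z - n%:Z - 1))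
     * q ^ expo_plus n j.

Definition diag_term_plus (K : numFieldType) (q : K) (j : nat) : K :=
  q ^ (3 * j%:Z ^+ 2 + j%:Z).

Definition diag_term_minus (K : numFieldType) (q : K) (j : nat) : K :=
  q ^ (3 * j%:Z ^+ 2 - j%:Z).

(* Main.v *)
(* Multiply R(z;q) by (zq, q/z; q)_oo: its n-th term becomes
   q^(n^2) (zq^(n+1), q^(n+1)/z; q)_oo, and Euler's expansion of both products
   turns the left-hand side into an absolutely convergent sum over triples
   (n, a, b). Grouping by k = a - b and N = n + min(a, b), the coefficient of
   (-1)^k z^k q^(|k|(|k|+1)/2) is
     sum_N q^(N^2+N|k|) beta_N,
     beta_N = sum_(b <= N) q^b / ((q)_b (q)_(b+|k|)).
   A telescoping argument exhibits beta_N as the beta-side of a Bailey pair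
   relative to a = q^|k|, whose alpha-side is
     alpha_0 = 1, alpha_r = - a^(2r-1) q^(2r^2-r) (1 - a q^(2r)),
   and the limiting case of Bailey's lemma gives
     (q)_oo sum_N q^(N^2+N|k|) beta_N = sum_r q^(r^2+r|k|) alpha_r.
   The two halves of alpha_r are the two families of terms of the Hecke-type
   double sum indexed by (k, r); both series of the statement are regroupings
   of this absolutely convergent double sum. *)
Require Import Defs.
From mathcomp Require Import all_boot all_order all_algebra.
From mathcomp Require Import complex finmap zify ring lra.
From mathcomp Require Import all_classical all_reals all_analysis.
Import Order.TTheory GRing.Theory Num.Theory.
Import numFieldNormedType.Exports.
Local Open Scope ring_scope.

Set Implicit Arguments.
Unset Strict Implicit.

(** * Unconditional sums *)

Section UnconditionalSums.
Local Open Scope classical_set_scope.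

(** The sets containing all finite supersets of some finite set: limits along this filter are limits
    of the net of finite partial sums, so that summation is independent of any order on the
    indices. *)
Definition fsets (I : choiceType) : set_system {fset I} :=
  filter_from setT (fun A => [set B | (A `<=` B)%fset]).

Arguments fsets : clear implicits.

#[local] Instance fsets_filter (I : choiceType) : ProperFilter (fsets I).
Proof.
apply: filter_from_proper; last by move=> A _; exists A => /=.
apply: filter_fromT_filter; first by exists fset0%fset.
by move=> A B; exists (A `|` B)%fset => C /=; rewrite fsubUset => /andP[].
Qed.

Definition has_sum (I : choiceType) (K : numFieldType) (f : I -> K) (s : K) :=
  (\sum_(i <- A) f i) @[A --> fsets I] --> s.

Lemma has_sumP (I : choiceType) (K : numFieldType) (f : I -> K) s :
  has_sum f s <-> forall e : K, 0 < e ->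
    exists A : {fset I}, forall B : {fset I}, (A `<=` B)%fset ->
      `|s - \sum_(i <- B) f i| < e.
Proof.
rewrite /has_sum; split => [/cvgrPdist_lt fs e /fs[A _ As]|fs].
  by exists A => B AB; apply: As.
apply/cvgrPdist_lt => e /fs[A As]; exists A => // B /= AB; exact: As.
Qed.

Lemma has_sum_unique (I : choiceType) (K : numFieldType) (f : I -> K) s t :
  has_sum f s -> has_sum f t -> s = t.
Proof. by move=> fs ft; apply: (cvg_unique _ fs ft). Qed.

Lemma has_sum0 (I : choiceType) (K : numFieldType) :
  has_sum (fun _ : I => 0 : K) 0.
Proof.
apply/has_sumP => e e0; exists fset0%fset => B _.
by rewrite big1 // subr0 normr0.
Qed.

Lemma has_sumD (I : choiceType) (K : numFieldType) (f g : I -> K) s t :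
  has_sum f s -> has_sum g t -> has_sum (fun i => f i + g i) (s + t).
Proof.
move=> fs gt; rewrite /has_sum.
under eq_fun do rewrite big_split.
exact: cvgD fs gt.
Qed.

Lemma has_sumZ (I : choiceType) (K : numFieldType) (c : K) (f : I -> K) s :
  has_sum f s -> has_sum (fun i => c * f i) (c * s).
Proof.
move=> fs; rewrite /has_sum.
under eq_fun do rewrite -mulr_sumr.
exact: cvgMr fs.
Qed.

Lemma has_sumB (I : choiceType) (K : numFieldType) (f g : I -> K) s t :
  has_sum f s -> has_sum g t -> has_sum (fun i => f i - g i) (s - t).
Proof.
move=> fs /(has_sumZ (c := -1)) gt.
have := has_sumD fs gt.
by rewrite mulN1r; under eq_fun do rewrite mulN1r.
Qed.

Lemma has_sum_big (I : choiceType) (K : numFieldType) (J : Type) (r : seq J)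
    (f : J -> I -> K) (s : J -> K) :
  (forall j, has_sum (f j) (s j)) ->
  has_sum (fun i => \sum_(j <- r) f j i) (\sum_(j <- r) s j).
Proof.
move=> fs; elim: r => [|j r IH].
  by rewrite big_nil; under eq_fun do rewrite big_nil; exact: has_sum0.
rewrite big_cons; under eq_fun do rewrite big_cons.
exact: has_sumD.
Qed.

Lemma big_fset_support (I : choiceType) (K : zmodType) (A B : {fset I})
    (f : I -> K) :
  (A `<=` B)%fset -> (forall i, i \in B -> i \notin A -> f i = 0) ->
  \sum_(i <- B) f i = \sum_(i <- A) f i.
Proof.
move=> AB f0; rewrite [LHS](big_fsetID _ (mem A))/=.
rewrite [X in _ + X]big1_fset ?addr0; last first.
  by move=> i; rewrite !inE/= => /andP[iB iA] _; exact: f0.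
apply: eq_fbigl => i; rewrite !inE/=.
by case: (boolP (i \in A)) => [/(fsubsetP AB) ->|_]; rewrite ?andbF.
Qed.

Lemma has_sum_support (I : choiceType) (K : numFieldType) (A : {fset I})
    (f : I -> K) :
  (forall i, i \notin A -> f i = 0) -> has_sum f (\sum_(i <- A) f i).
Proof.
move=> f0; apply/has_sumP => e e0; exists A => B AB.
by rewrite (big_fset_support AB) ?subrr ?normr0// => i _; exact: f0.
Qed.

(** Given a finite set [B] of classes containing the classes of [A], a large finite set [A] union
    [C] approximates all the class sums over [B] at once; its part [D] lying over [B] still contains
    [A], hence is also close to [s]. *)
Lemma has_sum_partition (I J : choiceType) (K : numFieldType) (p : I -> J)
    (f : I -> K) (g : J -> K) s :
  (forall j, has_sum (fun i => if p i == j then f i else 0) (g j)) ->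
  has_sum f s -> has_sum g s.
Proof.
move=> fg /has_sumP fs; apply/has_sumP => e e0.
have e20 : 0 < e / 2 by rewrite divr_gt0.
have [A As] := fs _ e20; exists [fset p i | i in A]%fset => B AB.
have /has_sumP/(_ _ e20)[C Cs] := has_sum_big (r := B) fg.
have {Cs} := Cs (A `|` C)%fset (fsubsetUr _ _).
pose D := [fset i in A `|` C | p i \in B]%fset.
have -> : \sum_(i <- (A `|` C)%fset) \sum_(j <- B) (if p i == j then f i else 0)
    = \sum_(i <- D) f i.
  have DC : (D `<=` A `|` C)%fset by apply/fsubsetP => i; rewrite !inE => /andP[].
  have sumE i : \sum_(j <- B) (if p i == j then f i else 0) =
      if p i \in B then f i else 0.
    case: ifPn => piB.
      rewrite (big_fsetD1 (p i))//= eqxx big1_fset ?addr0// => j.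
      by rewrite !inE eq_sym => /andP[/negbTE ->].
    rewrite big1_fset// => j jB _; case: eqP => // pij.
    by rewrite pij jB in piB.
  under eq_bigr do rewrite sumE.
  rewrite (big_fset_support DC); last first.
    by move=> i iC; rewrite !inE; move: iC; rewrite !inE => -> /= /negbTE ->.
  by apply: eq_big_seq => i; rewrite !inE => /andP[_ ->].
have AD : (A `<=` D)%fset.
  apply/fsubsetP => i iA; rewrite !inE iA /=.
  by apply: (fsubsetP AB); apply/imfsetP; exists i.
move=> h1; have h2 := As _ AD.
rewrite (_ : s - _ = (s - \sum_(i <- D) f i) -
  (\sum_(i <- B) g i - \sum_(i <- D) f i)); last by ring.
rewrite [e]splitr; apply: le_lt_trans (ler_normB _ _) _.
exact: ltrD.
Qed.

(** Extension by zero: since [h'] is a left inverse, the image of [h] is the set of fixed points of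
    [h \o h'], and [f] vanishes off it. *)
Lemma has_sum_embed (I J : choiceType) (K : numFieldType) (h : J -> I)
    (h' : I -> J) (f : I -> K) s :
  cancel h h' -> (forall i, h (h' i) != i -> f i = 0) ->
  has_sum (f \o h) s -> has_sum f s.
Proof.
move=> hK f0 /has_sumP fs; apply/has_sumP => e /fs[A As].
exists [fset h j | j in A]%fset => B AB.
have ABh : (A `<=` [fset h' i | i in B & h (h' i) == i])%fset.
  apply/fsubsetP => j jA; apply/imfsetP; exists (h j) => /=; rewrite ?hK//.
  rewrite inE /= hK eqxx andbT; apply: (fsubsetP AB); apply/imfsetP.
  by exists j.
have := As _ ABh; rewrite big_imfset/=; last first.
  move=> x y /andP[_ /eqP xE] /andP[_ /eqP yE] xy.
  by rewrite -xE xy yE.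
rewrite big_filter_cond/=.
set S := (X in s - X); suff -> : S = \sum_(i <- B) f i by [].
rewrite /S [RHS](bigID (fun i => h (h' i) == i))/=.
rewrite [X in _ + X]big1// addr0; apply: eq_big => [i|i /andP[]].
  by rewrite ?andbT.
by move=> /eqP ->.
Qed.

Lemma has_sum_fst (I J : choiceType) (K : numFieldType) (f : I * J -> K)
    (g : I -> K) s :
  (forall i, has_sum (fun j => f (i, j)) (g i)) ->
  has_sum f s -> has_sum g s.
Proof.
move=> fg; apply: (@has_sum_partition _ _ _ fst) => i.
apply: (@has_sum_embed _ _ _ (fun j => (i, j)) snd) => //=.
  by move=> [i' j] /=; case: (i' =P i) => // ->; rewrite eqxx.
rewrite (_ : _ \o _ = (fun j => f (i, j)))//.
by apply/funext => j /=; rewrite eqxx.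
Qed.

(** Regrouping along a map with finite fibers, the list [r j] enumerating the fiber over [j]. Each
    passage between a multiple sum and a series with finite inner sums uses this form. *)
Lemma has_sum_fibers (I J : choiceType) (K : numFieldType) (p : I -> J)
    (r : J -> seq I) (f : I -> K) s :
  (forall j, uniq (r j)) -> (forall i j, (i \in r j) = (p i == j)) ->
  has_sum f s -> has_sum (fun j => \sum_(i <- r j) f i) s.
Proof.
move=> ur rP; apply: (@has_sum_partition _ _ _ p) => j.
pose A := [fset i in r j]%fset.
have -> : \sum_(i <- r j) f i =
    \sum_(i <- A) (if p i == j then f i else 0).
  transitivity (\sum_(i <- r j) (if p i == j then f i else 0)).
    by apply: eq_big_seq => i; rewrite rP => ->.
  apply: perm_big; apply: uniq_perm => // i.
  by rewrite !inE.
apply: has_sum_support => i.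
by rewrite !inE rP => /negbTE ->.
Qed.

(** The initial segments of the naturals eventually contain any given finite set, so the net limit
    is also the limit of the ordered partial sums. *)
Lemma has_sum_psum (K : numFieldType) (m : nat) (f : nat -> K) s :
  has_sum (fun n => if (m <= n)%N then f n else 0) s ->
  psum m f @ \oo --> s.
Proof.
move=> /has_sumP fs; apply/cvgrPdist_lt => e /fs[A As].
exists (\max_(i <- A) i).+1 => // N /= AN.
have : (A `<=` [fset i in iota 0 N])%fset.
  apply/fsubsetP => i iA; rewrite !inE mem_iota/= add0n.
  by apply: leq_ltn_trans AN; apply: leq_bigmax_seq.
move=> /As; set S := (X in s - X); suff -> : S = psum m f N by [].
rewrite /S /psum.
transitivity (\sum_(i <- iota 0 N) (if (m <= i)%N then f i else 0)).
  apply: perm_big; apply: uniq_perm; rewrite ?iota_uniq// => i.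
  by rewrite !inE.
rewrite -big_mkcond/= [RHS](@big_nat_widenl _ _ _ _ 0)//=.
by rewrite /index_iota subn0.
Qed.

End UnconditionalSums.

(** * Absolute summability *)

Section AbsoluteSummability.
Local Open Scope classical_set_scope.

Definition abs_summable (I : choiceType) (K : numFieldType) (f : I -> K) :=
  exists B : K, forall A : {fset I}, \sum_(i <- A) `|f i| <= B.

Lemma ler_sum_fset_seq (I : choiceType) (K : numFieldType) (A : {fset I})
    (r : seq I) (f : I -> K) :
  uniq r -> {subset A <= r} -> (forall i, 0 <= f i) ->
  \sum_(i <- A) f i <= \sum_(i <- r) f i.
Proof.
move=> ur Ar f0; rewrite [leRHS](bigID (fun i => i \in A))/=.
rewrite -[leLHS]addr0 lerD ?sumr_ge0// -[leRHS]big_filter.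
rewrite (@perm_big _ _ _ _ [seq i <- r | i \in A] A)//.
apply: uniq_perm; rewrite ?filter_uniq// => i.
by rewrite mem_filter; case: (boolP (i \in A)) => // /Ar.
Qed.

Lemma abs_summable_le (I : choiceType) (K : numFieldType) (f g : I -> K) :
  (forall i, `|f i| <= `|g i|) -> abs_summable g -> abs_summable f.
Proof.
by move=> fg [B Bg]; exists B => A; apply: le_trans (Bg A); exact: ler_sum.
Qed.

Lemma abs_summableD (I : choiceType) (K : numFieldType) (f g : I -> K) :
  abs_summable f -> abs_summable g -> abs_summable (fun i => f i + g i).
Proof.
move=> [B Bf] [C Cg]; exists (B + C) => A.
apply: le_trans (lerD (Bf A) (Cg A)); rewrite -big_split/=.
by apply: ler_sum => i _; exact: ler_normD.
Qed.

Lemma abs_summableZ (I : choiceType) (K : numFieldType) (c : K) (f : I -> K) :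
  abs_summable f -> abs_summable (fun i => c * f i).
Proof.
move=> [B Bf]; exists (`|c| * B) => A.
by under eq_bigr do rewrite normrM; rewrite -mulr_sumr ler_wpM2l.
Qed.

Lemma abs_summable_inj (I J : choiceType) (K : numFieldType) (h : J -> I)
    (f : I -> K) :
  injective h -> abs_summable f -> abs_summable (f \o h).
Proof.
move=> hI [B Bf]; exists B => A; apply: le_trans (Bf [fset h j | j in A]%fset).
by rewrite big_imfset//= => x y _ _; exact: hI.
Qed.

(** A finite set of pairs lies in the product of its two projections, over which the sum of norms
    factors. *)
Lemma abs_summable_prod (I J : choiceType) (K : numFieldType) (f : I -> K)
    (g : J -> K) :
  abs_summable f -> abs_summable g ->
  abs_summable (fun x : I * J => f x.1 * g x.2).
Proof.
move=> [B Bf] [C Cg]; exists (B * C) => A.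
pose A1 := [fset x.1 | x in A]%fset; pose A2 := [fset x.2 | x in A]%fset.
apply: le_trans (ler_pM _ _ (Bf A1) (Cg A2)); try exact: sumr_ge0.
have -> : (\sum_(i <- A1) `|f i|) * (\sum_(j <- A2) `|g j|) =
    \sum_(x <- allpairs pair A1 A2) `|f x.1 * g x.2|.
  rewrite big_allpairs mulr_suml; apply: eq_bigr => i _.
  by rewrite mulr_sumr; apply: eq_bigr => j _; rewrite normrM.
apply: ler_sum_fset_seq => //.
  by apply: allpairs_uniq => // -[? ?] [? ?].
move=> [i j] xA; apply/allpairsP; exists (i, j); split=> //=.
- by apply/imfsetP; exists (i, j).
- by apply/imfsetP; exists (i, j).
Qed.

Lemma abs_summable_fin (I : finType) (K : numFieldType) (f : I -> K) :
  abs_summable f.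
Proof.
exists (\sum_(i <- enum I) `|f i|) => A.
by apply: ler_sum_fset_seq; rewrite ?enum_uniq// => i _; rewrite mem_enum.
Qed.

(** The map sending [k] to its sign and absolute value embeds the integers in [bool * nat]. *)
Lemma abs_summable_absz (K : numFieldType) (f : nat -> K) :
  abs_summable f -> abs_summable (fun k : int => f `|k|%N).
Proof.
move=> fs; pose h (k : int) := (k < 0, `|k|%N).
have hI : injective h by move=> k l [] + kl; case: k l kl => [m|m] [n|n]; lia.
have := abs_summable_inj hI
  (abs_summable_prod (@abs_summable_fin bool K (fun=> 1)) fs).
by apply: abs_summable_le => k /=; rewrite mul1r.
Qed.

Lemma abs_summable_geometric (K : numFieldType) (r : K) :
  `|r| < 1 -> abs_summable (fun n => r ^+ n).
Proof.
move=> r1; have d0 : 0 < 1 - `|r| by rewrite subr_gt0.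
exists (1 - `|r|)^-1 => A.
have geo N : \sum_(0 <= i < N) `|r ^+ i| <= (1 - `|r|)^-1.
  rewrite -[leRHS]mul1r ler_pdivlMr//.
  suff -> : (\sum_(0 <= i < N) `|r ^+ i|) * (1 - `|r|) = 1 - `|r| ^+ N.
    by rewrite gerBl exprn_ge0.
  elim: N => [|N IH]; first by rewrite big_geq// expr0 mul0r subrr.
  by rewrite big_nat_recr//= mulrDl IH normrX exprS; ring.
apply: le_trans (geo (\max_(i <- A) i).+1).
apply: ler_sum_fset_seq; rewrite ?iota_uniq// => i iA.
by rewrite mem_index_iota/= ltnS; apply: leq_bigmax_seq.
Qed.

(* The library has no completeness instance for [R[i]]; the q-series are
   therefore summed over any [numFieldType] with this property. *)
Definition summation_complete (K : numFieldType) :=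
  forall (I : choiceType) (f : I -> K), abs_summable f -> exists s, has_sum f s.

End AbsoluteSummability.

(** * Absolutely summable families of complex numbers are summable *)

Section ComplexSums.
Local Open Scope classical_set_scope.
Local Open Scope complex_scope.
Variable R : realType.
Local Notation C := (R[i] : numFieldType).

(** A nonnegative family converges to the supremum of its finite sums; the general case writes [f]
    as the difference of the nonnegative families [f + |f|] and [|f|]. *)
Lemma abs_summable_real (I : choiceType) (f : I -> R) :
  abs_summable f -> exists s, has_sum f s.
Proof.
have nonneg (g : I -> R) : (forall i, 0 <= g i) -> abs_summable g ->
    exists s, has_sum g s.
  move=> g0 [B gB].
  pose S := [set \sum_(i <- A) g i | A in [set: {fset I}]].
  have supS : has_sup S.
    split; first by exists (\sum_(i <- fset0) g i), fset0.
    exists B => _ [A _ <-]; apply: le_trans (gB A).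
    by apply: ler_sum => i _; exact: ler_norm.
  exists (sup S); apply/has_sumP => e e0.
  have [_ [A _ <-] SA] := sup_adherent e0 supS.
  exists A => D AD.
  have gAD : \sum_(i <- A) g i <= \sum_(i <- D) g i.
    by apply: ler_sum_fset_seq => //; exact/fsubsetP.
  have gD : \sum_(i <- D) g i <= sup S.
    by apply: ub_le_sup; [case: supS | exists D].
  by rewrite ger0_norm ?subr_ge0//; lra.
move=> fs.
have [s hs] : exists s, has_sum (fun i => `|f i|) s.
  by apply: nonneg => //; apply: abs_summable_le fs => i; rewrite normr_id.
have [t ht] : exists t, has_sum (fun i => f i + `|f i|) t.
  apply: nonneg; first by move=> i; have := ler_norm (- f i); rewrite normrN; lra.
  by apply: abs_summableD => //; apply: abs_summable_le fs => i; rewrite normr_id.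
exists (t - s); have := has_sumB ht hs.
by under eq_fun do rewrite addrK.
Qed.

Lemma has_sum_real_complex (I : choiceType) (f : I -> R) s :
  has_sum f s -> has_sum (fun i => (f i)%:C : C) s%:C.
Proof.
move=> /has_sumP fs; apply/has_sumP => e e0.
(* A positive element of [R[i]] is real, so a complex tolerance is a real one. *)
have eE : e = (complex.Re e)%:C by rewrite RRe_real// gtr0_real.
have [|A As] := fs (complex.Re e); first by rewrite -ltcR -eE.
exists A => B /As; rewrite -ltcR -eE; apply: le_lt_trans.
rewrite -raddf_sum -raddfB normc_def/= expr0n/= addr0 sqrtr_sqr.
exact: lexx.
Qed.

Lemma Re_le_norm (x : C) : `|complex.Re x|%:C <= `|x|.
Proof.
by rewrite normc_def lecR -sqrtr_sqr ler_wsqrtr// lerDl sqr_ge0.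
Qed.

Lemma Im_le_norm (x : C) : `|complex.Im x|%:C <= `|x|.
Proof.
by rewrite normc_def lecR -sqrtr_sqr ler_wsqrtr// lerDr sqr_ge0.
Qed.

Lemma complex_summation_complete : summation_complete C.
Proof.
move=> I f [B fB].
have part (g : C -> R) : (forall x, `|g x|%:C <= `|x|) ->
    exists s, has_sum (fun i => g (f i)) s.
  move=> gle; apply: abs_summable_real; exists (complex.Re B) => A.
  rewrite -lecR; apply: (@le_trans _ _ B).
    apply: le_trans (fB A); rewrite raddf_sum/=.
    by apply: ler_sum => i _; exact: gle.
  have : 0 <= B by apply: le_trans (fB fset0); apply: sumr_ge0.
  by move/ger0_real/RRe_real ->.
have [s hs] := part _ Re_le_norm; have [t ht] := part _ Im_le_norm.
exists (s%:C + 'i * t%:C).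
have := has_sumD (has_sum_real_complex hs)
  (has_sumZ (c := 'i) (has_sum_real_complex ht)).
by under eq_fun do rewrite -complexE.
Qed.

End ComplexSums.

(** * Dominated convergence, products and majorants over a complete field *)

Section CompleteSums.
Local Open Scope classical_set_scope.
Variable K : numFieldType.
Hypothesis summationK : summation_complete K.

(** Tannery's theorem: a finite set [A] carries nearly all of the majorant, so both sums are nearly
    their parts over [A], where the limit is that of a finite sum. *)
Lemma has_sum_dominated (I : choiceType) (f : nat -> I -> K) (g : I -> K)
    (F : I -> K) (s : nat -> K) S :
  abs_summable g -> (forall n i, `|f n i| <= `|g i|) ->
  (forall i, f n i @[n --> \oo] --> F i) ->
  (forall n, has_sum (f n) (s n)) -> has_sum F S -> s n @[n --> \oo] --> S.
Proof.
move=> gs fg fF fs FS.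
(* The bound passes to the limit: a gap between [F i] and the majorant would contradict some [f n i]
   closer to [F i] than that gap. *)
have Fg i : `|F i| <= `|g i|.
  rewrite real_leNgt ?normr_real//; apply/negP; rewrite -subr_gt0 => d0.
  have /cvgrPdist_lt/(_ _ d0)[n _ /(_ n (leqnn n))] := fF i.
  apply/negP; rewrite -real_leNgt ?rpredB ?normr_real//=.
  rewrite lerBlDr -{1}[F i](subrK (f n i)).
  by apply: le_trans (ler_normD _ _) _; rewrite lerD2l.
have [G hG] : exists G, has_sum (fun i => `|g i|) G.
  by apply: summationK; apply: abs_summable_le gs => i; rewrite normr_id.
apply/cvgrPdist_lt => e e0.
(* Seven shares: three for the tail of [F], three for the tail of [f n], one for the finite part
   over [A]. *)
pose d := e / 7%:R; have d0 : 0 < d by rewrite divr_gt0.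
have /has_sumP/(_ _ d0)[A As] := hG.
have tail (h : I -> K) t : (forall i, `|h i| <= `|g i|) -> has_sum h t ->
    `|t - \sum_(i <- A) h i| < d + (d + d).
  move=> hg /has_sumP/(_ _ d0)[B Bs].
  pose D := (A `|` B)%fset.
  rewrite (_ : t - _ = (t - \sum_(i <- D) h i) +
     (\sum_(i <- D) h i - \sum_(i <- A) h i)); last by ring.
  apply: le_lt_trans (ler_normD _ _) _.
  apply: ltrD; first exact/Bs/fsubsetUr.
  have diffE (u : I -> K) :
      \sum_(i <- D) u i - \sum_(i <- A) u i = \sum_(i <- D | i \notin A) u i.
    rewrite [X in X - _](bigID (fun i => i \in A))/= -[X in X + _ - _]big_filter.
    rewrite (@perm_big _ _ _ _ [seq i <- D | i \in A] A); first by rewrite addrC addKr.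
    apply: uniq_perm; rewrite ?filter_uniq// => i.
    by rewrite mem_filter inE; case: (i \in A).
  (* On [D] minus [A] the terms of [h] are dominated by the norms of those of [g], whose sum is a
     difference of two errors in approximating [G], each below [d]. *)
  apply: (@le_lt_trans _ _ (\sum_(i <- D | i \notin A) `|g i|)).
    rewrite diffE; apply: le_trans (ler_norm_sum _ _ _) _.
    by apply: ler_sum => i _; exact: hg.
  rewrite -diffE -[ltLHS]ger0_norm; last by rewrite diffE sumr_ge0.
  rewrite (_ : _ - _ = (G - \sum_(i <- A) `|g i|) - (G - \sum_(i <- D) `|g i|)).
    apply: le_lt_trans (ler_normB _ _) _.
    by apply: ltrD; apply: As => //; exact: fsubsetUl.
  by ring.
have /cvgrPdist_lt/(_ _ d0) :
    \sum_(i <- A) f n i @[n --> \oo] --> \sum_(i <- A) F i.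
  by apply: cvg_big => [|i _]; [exact: add_continuous | exact: fF].
apply: filterS => n nA.
rewrite (_ : S - s n = (S - \sum_(i <- A) F i) +
  (\sum_(i <- A) F i - \sum_(i <- A) f n i) - (s n - \sum_(i <- A) f n i));
  last by ring.
apply: le_lt_trans (ler_normB _ _) _.
have -> : e = d + (d + d) + d + (d + (d + d)) by rewrite /d; field.
apply: ltrD; last exact: (tail (f n) (s n) (fg n) (fs n)).
apply: le_lt_trans (ler_normD _ _) _; apply: ltrD => //; exact: (tail F S Fg FS).
Qed.



(** Summability of the products provides some sum [u] over pairs; summing first over one coordinate
    identifies [u] with [s * t]. *)
Lemma has_sum_prod (I J : choiceType) (f : I -> K) (g : J -> K) s t :
  abs_summable f -> abs_summable g -> has_sum f s -> has_sum g t ->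
  has_sum (fun x : I * J => f x.1 * g x.2) (s * t).
Proof.
move=> af ag fs gt; have [u hu] := summationK (abs_summable_prod af ag).
suff -> : s * t = u by [].
have h1 : has_sum (fun i => f i * t) u.
  by apply: has_sum_fst hu => i; exact: has_sumZ.
apply: has_sum_unique h1; rewrite mulrC.
by under eq_fun do rewrite mulrC; exact: has_sumZ.
Qed.

(** Completeness replaces the Archimedean property, which is not assumed of [K]: the terms of a
    summable series tend to zero. *)
Lemma cvg_expr_complete (x : K) : `|x| < 1 -> x ^+ n @[n --> \oo] --> (0 : K).
Proof.
move=> x1; have [s hs] := summationK (abs_summable_geometric x1).
apply: (@cvg_series_cvg_0 K K); apply/cvg_ex; exists s.
exact: (@has_sum_psum _ 0).
Qed.

(** The ratio of consecutive terms is [c * r ^+ n], which is at most 1 from some index [m] on; the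
    sum of the terms up to [m] is then a bound. *)
Lemma superexp_bounded (r c : K) : 0 <= r < 1 -> 0 <= c ->
  exists2 B, 0 <= B & forall n, c ^+ n * r ^+ 'C(n, 2) <= B.
Proof.
move=> /andP[r0 r1] c0; pose u n := c ^+ n * r ^+ 'C(n, 2).
have u0 n : 0 <= u n by rewrite mulr_ge0 ?exprn_ge0.
have uS n : u n.+1 = c * r ^+ n * u n.
  by rewrite /u binS bin1 exprD exprS; ring.
have [m rm] : exists m, c * r ^+ m <= 1.
  have rn : `|r| < 1 by rewrite ger0_norm.
  have : c * r ^+ n @[n --> \oo] --> c * 0.
    by apply: cvgMr; exact: cvg_expr_complete rn.
  rewrite mulr0 => /cvgrPdist_lt/(_ _ ltr01)[m _ /(_ m (leqnn m))] /=.
  by rewrite sub0r normrN ger0_norm ?mulr_ge0 ?exprn_ge0// => /ltW; exists m.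
exists (\sum_(i < m.+1) u i); first exact: sumr_ge0.
have um n : (n <= m)%N -> u n <= \sum_(i < m.+1) u i.
  by move=> nm; rewrite (bigD1 (Ordinal (nm : n < m.+1)%N))//= lerDl sumr_ge0.
move=> n; rewrite -/(u n); have [/um//|/ltnW mn] := leqP n m.
rewrite -(subnK mn); elim: (n - m)%N => [|k IH]; first exact: um.
apply: le_trans IH; rewrite addSn uS ler_piMl//.
apply: le_trans rm; rewrite ler_wpM2l// ler_wiXn2l ?leq_addl// ltW//.
Qed.

Lemma abs_summable_superexp (r c : K) : 0 <= r < 1 -> 0 <= c ->
  abs_summable (fun n => c ^+ n * r ^+ 'C(n, 2)).
Proof.
(* Bounding the sequence for [2 * c] leaves a factor [2 ^- n], hence a geometric majorant. *)
move=> r01 c0; have c20 : 0 <= 2 * c by rewrite mulr_ge0.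
have [B B0 cB] := superexp_bounded r01 c20.
have h1 : `|2^-1 : K| < 1 by rewrite ger0_norm ?invr_ge0// invf_lt1// ltr1n.
apply: abs_summable_le (abs_summableZ B (abs_summable_geometric h1)) => n.
have /andP[r0 _] := r01.
rewrite !ger0_norm ?mulr_ge0 ?exprn_ge0 ?invr_ge0//.
rewrite exprVn ler_pdivlMr ?exprn_gt0//.
by apply: le_trans (cB n); rewrite exprMn -[leRHS]mulrA [leRHS]mulrC.
Qed.

Lemma cvgn_norm_bounded (u : nat -> K) (l : K) :
  u n @[n --> \oo] --> l -> exists2 B : K, 0 <= B & forall n, `|u n| <= B.
Proof.
move=> /cvgrPdist_lt/(_ _ ltr01)[N _ uN].
have S0 : 0 <= \sum_(i < N) `|u i| by exact: sumr_ge0.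
exists (\sum_(i < N) `|u i| + (`|l| + 1)); first by rewrite !addr_ge0.
move=> n; have [nN|/uN /= /ltW un] := ltnP n N.
  rewrite (bigD1 (Ordinal nN))//= -addrA lerDl.
  by rewrite !addr_ge0// sumr_ge0.
apply: (@le_trans _ _ (`|l| + 1)); last by rewrite lerDr.
rewrite -[u n](subrK l) addrC; apply: le_trans (ler_normD _ _) _.
by rewrite lerD2l distrC.
Qed.

End CompleteSums.

(** * A Bailey pair *)

Section FiniteIdentities.
Variables (K : numFieldType) (q : K).
Hypothesis qpoch_neq0 : forall n, qpoch q q n != 0.

Local Notation "[ 'iq' n ]" := (qpoch q q n)^-1.

Lemma qpochS (a : K) n : qpoch a q n.+1 = qpoch a q n * (1 - a * q ^+ n).
Proof. by rewrite /qpoch big_nat_recr. Qed.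

Lemma qpoch0 (a : K) : qpoch a q 0 = 1.
Proof. by rewrite /qpoch big_geq. Qed.

Lemma subr1_expr_neq0 n : 1 - q ^+ n.+1 != 0.
Proof.
have := qpoch_neq0 n.+1; rewrite qpochS mulf_eq0 negb_or exprS.
by move=> /andP[].
Qed.

Lemma qpochVS n : [iq n.+1] = [iq n] / (1 - q ^+ n.+1).
Proof. by rewrite qpochS invfM exprS. Qed.

Lemma qpochV n : [iq n] = [iq n.+1] * (1 - q ^+ n.+1).
Proof. by rewrite qpochVS divfK// subr1_expr_neq0. Qed.

(* A limiting case of the q-Chu-Vandermonde sum; the q-Pascal recurrence
   reduces [M.+1, k] to [M, k.+1]. *)
Lemma qVandermonde M k :
  \sum_(0 <= m < M.+1) q ^+ (m * (m + k)) * [iq m] * [iq (M - m)] * [iq (m + k)]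
  = [iq M] * [iq (M + k)].
Proof.
elim: M k => [|M IH] k.
  by rewrite big_nat1 mul0n expr0 add0n subnn qpoch0 invr1 !mul1r.
apply: (mulfI (subr1_expr_neq0 M)).
rewrite [RHS]mulrA [_ * [iq M.+1]]mulrC -qpochV addSnnS -IH mulr_sumr.
pose u m := q ^+ (m * (m + k)) * q ^+ m * [iq m] * ([iq (M.+1 - m)] * (1 - q ^+ (M.+1 - m)))
   * [iq (m + k)].
pose v m := q ^+ (m * (m + k)) * ([iq m] * (1 - q ^+ m)) * [iq (M.+1 - m)]
   * [iq (m + k)].
transitivity (\sum_(0 <= m < M.+2) u m + \sum_(0 <= m < M.+2) v m).
  rewrite -big_split/=; apply: eq_big_nat => m /andP[_ mM].
  have -> : q ^+ M.+1 = q ^+ m * q ^+ (M.+1 - m) by rewrite -exprD subnKC.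
  by rewrite /u /v; ring.
rewrite [X in X + _ = _]big_nat_recr//= {2}/u subnn expr0 subrr !mulr0 mul0r addr0.
rewrite [X in _ + X = _]big_nat_recl//= {1}/v expr0 subrr !mulr0 !mul0r add0r.
rewrite -big_split/=; apply: eq_big_nat => m /andP[_ mM].
rewrite /u /v subSS (subSn (mM : (m <= M)%N)) -!qpochV addSnnS.
have -> : [iq (m + k)] = [iq (m + k.+1)] * (1 - q ^+ (m + k.+1)).
  by rewrite addnS -qpochV.
have -> : q ^+ (m.+1 * (m + k.+1)) =
    q ^+ (m * (m + k)) * q ^+ m * q ^+ (m + k.+1).
  by rewrite -!exprD; congr (_ ^+ _); lia.
have -> : q ^+ (m * (m + k.+1)) = q ^+ (m * (m + k)) * q ^+ m.
  by rewrite -exprD; congr (_ ^+ _); lia.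
by ring.
Qed.

Definition bailey_beta k N := \sum_(0 <= b < N.+1) q ^+ b * [iq b] * [iq (b + k)].

Definition bailey_alpha k r :=
  if r is j.+1 then - q ^+ ((2 * j).+1 * (k + j.+1)) * (1 - q ^+ (k + 2 * j.+1))
  else 1.

(* The sum telescopes: for [r > 0] the [r]-th summand is
   [q ^+ N.+1 * (T r.+1 - T r)], where [T m.+1] is the last product inside the
   parentheses of the right-hand side. *)
Lemma bailey_step k N m : (m <= N)%N ->
  \sum_(0 <= r < m.+1) bailey_alpha k r *
    ([iq (N.+1 - r)] * [iq (N.+1 + r + k)] - [iq (N - r)] * [iq (N + r + k)])
  = q ^+ N.+1 * ([iq N.+1] * [iq (N.+1 + k)]
     + q ^+ ((2 * m).+1 * k + 2 * m * m.+1) * [iq (N - m)] * [iq (N + m.+1 + k)]).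
Proof.
elim: m => [_|m IH mN].
  rewrite big_nat1 mul1r !subn0 !addn0 muln0 mul1n addn1 !addSn.
  rewrite (qpochVS N) (qpochVS (N + k)).
  have := subr1_expr_neq0 N; have := subr1_expr_neq0 (N + k).
  rewrite -addSn exprD; set x := q ^+ N.+1; set y := q ^+ k => h1 h2.
  by field; rewrite h1 h2 !qpoch_neq0.
rewrite big_nat_recr//= IH ?(ltnW mN)//.
(* This substitution removes the truncated subtractions; all exponents then become sums of [k],
   [p.+1] and multiples of [m.+1], up to one common factor. *)
have [p ->] : exists p, N = (m.+1 + p)%N by exists (N - m.+1)%N; rewrite subnKC.
have -> : (m.+1 + p - m = p.+1)%N by lia.
have -> : ((m.+1 + p).+1 - m.+1 = p.+1)%N by lia.
have -> : (m.+1 + p - m.+1 = p)%N by lia.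
set L := (m.+1 + p + m.+1 + k)%N.
have -> : ((m.+1 + p).+1 + m.+1 + k = L.+1)%N by lia.
have -> : (m.+1 + p + m.+2 + k = L.+1)%N by lia.
rewrite (qpochVS p) (qpochVS L).
have := subr1_expr_neq0 p; have := subr1_expr_neq0 L.
have -> : q ^+ L.+1 = q ^+ k * q ^+ p.+1 * q ^+ m.+1 * q ^+ m.+1.
  by rewrite -!exprD; congr (_ ^+ _); lia.
have -> : q ^+ (m.+1 + p).+1 = q ^+ m.+1 * q ^+ p.+1.
  by rewrite -!exprD; congr (_ ^+ _); lia.
have -> : q ^+ ((2 * m).+1 * (k + m.+1)) =
    q ^+ ((2 * m).+1 * k + 2 * m * m.+1) * q ^+ m.+1.
  by rewrite -!exprD; congr (_ ^+ _); lia.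
have -> : q ^+ ((2 * m.+1).+1 * k + 2 * m.+1 * m.+2) =
    q ^+ ((2 * m).+1 * k + 2 * m * m.+1) *
    (q ^+ k * q ^+ m.+1 * q ^+ m.+1) ^+ 2.
  by rewrite -!exprD -exprM -exprD; congr (_ ^+ _); lia.
have -> : q ^+ (k + 2 * m.+1) = q ^+ k * q ^+ m.+1 * q ^+ m.+1.
  by rewrite -!exprD; congr (_ ^+ _); lia.
(* With the powers abstracted, only a rational identity in independent variables is left. *)
move: (q ^+ k) (q ^+ p.+1) (q ^+ m.+1) (q ^+ _) [iq (m.+1 + p).+1]
  [iq ((m.+1 + p).+1 + k)] [iq p] [iq L].
move=> w v u e A B D E h1 h2.
by field; rewrite h1 h2.
Qed.

(** Induction on [N]: [bailey_step] at [m = N] gives the change of the terms with [r <= N]. Its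
    first part is the new term of [bailey_beta], and its second part cancels the new term
    [r = N.+1]. *)
Lemma bailey_pair k N :
  bailey_beta k N =
  \sum_(0 <= r < N.+1) bailey_alpha k r * [iq (N - r)] * [iq (N + r + k)].
Proof.
elim: N => [|N IH]; rewrite /bailey_beta.
  by rewrite !big_nat1 expr0 /= !mul1r.
rewrite big_nat_recr//= -/(bailey_beta k N) IH.
rewrite [RHS]big_nat_recr//=.
have := bailey_step k (leqnn N).
under [X in X = _ -> _]eq_bigr do rewrite mulrBr !mulrA.
rewrite sumrB => /eqP; rewrite subr_eq => /eqP ->.
rewrite !subnn qpoch0 invr1 !mulr1.
have -> : [iq (N + N.+1 + k)] =
    [iq (N.+1 + N.+1 + k)] * (1 - q ^+ (k + 2 * N.+1)).
  have -> : (N.+1 + N.+1 + k = (N + N.+1 + k).+1)%N by lia.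
  by rewrite qpochV; congr (_ * (1 - _ ^+ _)); lia.
have -> : q ^+ ((2 * N).+1 * (k + N.+1)) =
    q ^+ N.+1 * q ^+ ((2 * N).+1 * k + 2 * N * N.+1).
  by rewrite -!exprD; congr (_ ^+ _); lia.
by ring.
Qed.

Lemma sum_triangle (F : nat -> nat -> K) M :
  \sum_(0 <= N < M) \sum_(0 <= r < N.+1) F N r =
  \sum_(0 <= r < M) \sum_(r <= N < M) F N r.
Proof.
elim: M => [|M IH]; first by rewrite !big_geq.
rewrite big_nat_recr//= IH [RHS]big_nat_recr//= big_nat1.
rewrite big_nat_recr//= addrA; congr (_ + _).
rewrite -big_split/=; apply: eq_big_nat => r /andP[_ rM].
by rewrite big_nat_recr//= ltnW.
Qed.

(** After inserting the Bailey pair and exchanging sums, the inner sum over [N >= r] is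
    [qVandermonde] for [M - r] and [2 * r + k], with [N = m + r]. *)
Lemma finite_bailey_lemma k M :
  \sum_(0 <= N < M.+1) q ^+ (N * (N + k)) * [iq (M - N)] * bailey_beta k N =
  \sum_(0 <= r < M.+1) q ^+ (r * (r + k)) * bailey_alpha k r
    * [iq (M - r)] * [iq (M + r + k)].
Proof.
under eq_bigr do rewrite bailey_pair mulr_sumr.
rewrite sum_triangle; apply: eq_big_nat => r /andP[_ rM].
rewrite -{1}[r]add0n big_addn subSn//.
have := qVandermonde (M - r) (2 * r + k).
have -> : (M - r + (2 * r + k) = M + r + k)%N by lia.
move=> V; rewrite -[RHS]mulrA -V mulr_sumr.
apply: eq_big_nat => m /andP[_ mM].
have -> : q ^+ ((m + r) * (m + r + k)) =
    q ^+ (r * (r + k)) * q ^+ (m * (m + (2 * r + k))).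
  by rewrite -!exprD; congr (_ ^+ _); lia.
have -> : (M - (m + r) = M - r - m)%N by lia.
have -> : (m + r - r = m)%N by lia.
have -> : (m + r + r + k = m + (2 * r + k))%N by lia.
by ring.
Qed.

End FiniteIdentities.

(** * Euler's expansion of infinite products *)

Section EulerProduct.
Local Open Scope classical_set_scope.
Variable K : numFieldType.
Hypothesis summationK : summation_complete K.
Variable q : K.
Hypothesis q_lt1 : `|q| < 1.

Local Notation "[ 'iq' n ]" := (qpoch q q n)^-1.

Let q_le1 : `|q| <= 1. Proof. exact: ltW. Qed.

Lemma qpoch_q_neq0 n : qpoch q q n != 0.
Proof.
rewrite /qpoch prodf_seq_neq0; apply/allP => i _ /=.
rewrite subr_eq0 -exprS; apply/eqP => q1.
have : `|q ^+ i.+1| < 1 by rewrite normrX exprn_ilt1.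
by rewrite -q1 normr1 ltxx.
Qed.

(** The general term of Euler's series for the infinite product [(x; q)_oo]. *)
Definition euler_term (x : K) a : K :=
  (-1) ^+ a * q ^+ 'C(a, 2) * x ^+ a * [iq a].

(** Each factor of the q-factorial has norm at least [1 - |q|]. *)
Lemma norm_qpochV_le n : `|[iq n]| <= (1 - `|q|)^-1 ^+ n.
Proof.
have d0 : 0 < 1 - `|q| by rewrite subr_gt0.
elim: n => [|n IH]; first by rewrite qpoch0 invr1 normr1.
rewrite qpochVS normrM [leRHS]exprSr ler_pM// normfV lef_pV2 ?posrE//; last first.
  by rewrite normr_gt0 (subr1_expr_neq0 qpoch_q_neq0).
apply: le_trans (lerB_dist _ _); rewrite normr1 lerD2l lerN2 normrX.
by rewrite exprS ler_piMr// exprn_ile1.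
Qed.

Lemma norm_euler_term_le x a : `|euler_term x a| <=
  (`|x| / (1 - `|q|)) ^+ a * `|q| ^+ 'C(a, 2).
Proof.
rewrite /euler_term !normrM normrX normrN1 expr1n mul1r !normrX exprMn.
rewrite [leRHS]mulrC mulrA.
by apply: ler_wpM2l (norm_qpochV_le a); rewrite mulr_ge0 ?exprn_ge0.
Qed.

Lemma abs_summable_euler x : abs_summable (euler_term x).
Proof.
have c0 : 0 <= `|x| / (1 - `|q|) by rewrite divr_ge0// subr_ge0.
have q01 : 0 <= `|q| < 1 by rewrite normr_ge0.
apply: abs_summable_le (abs_summable_superexp summationK q01 c0) => a.
by rewrite [leRHS]ger0_norm ?norm_euler_term_le// mulr_ge0 ?exprn_ge0.
Qed.

Lemma euler_term_le x y a : `|x| <= `|y| -> `|euler_term x a| <= `|euler_term y a|.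
Proof.
move=> xy; rewrite /euler_term !normrM !normrX.
apply: ler_wpM2r; first exact: normr_ge0.
apply: ler_wpM2l; first by rewrite mulr_ge0 ?exprn_ge0 ?normr_ge0.
by apply: lerXn2r; rewrite ?nnegrE ?normr_ge0.
Qed.

(* The partial-sum form of [E x = (1 - x) * E (x * q)]. *)
Lemma euler_term_functional x N :
  \sum_(0 <= a < N.+1) (euler_term x a - euler_term (x * q) a) =
  - x * \sum_(0 <= a < N) euler_term (x * q) a.
Proof.
rewrite big_nat_recl//= {1 2}/euler_term !expr0 subrr add0r mulr_sumr.
apply: eq_bigr => a _; rewrite /euler_term binS bin1 exprD.
by rewrite (qpochV qpoch_q_neq0 a) !exprMn !exprS; ring.
Qed.

Lemma euler_sum_qmul x s t : has_sum (euler_term x) s ->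
  has_sum (euler_term (x * q)) t -> s = (1 - x) * t.
Proof.
move=> hs ht; have d := @has_sum_psum _ 0 _ _ (has_sumB hs ht).
have t1 := @has_sum_psum _ 0 _ _ ht.
have t' : - x * psum 0 (euler_term (x * q)) n @[n --> \oo] --> - x * t.
  by apply: cvgMr; exact: t1.
have : psum 0 (fun a => euler_term x a - euler_term (x * q) a) n @[n --> \oo] --> - x * t.
  rewrite -cvg_shiftS; apply: cvg_trans t'; apply: near_eq_cvg.
  by near=> n; rewrite /= /psum euler_term_functional.
move=> d'; have : s - t = - x * t by apply: (cvg_unique _ d d').
by move=> /eqP; rewrite subr_eq => /eqP ->; ring.
Unshelve. all: by end_near. Qed.

Lemma euler_sum_iter x s t n : has_sum (euler_term x) s ->
  has_sum (euler_term (x * q ^+ n)) t -> s = qpoch x q n * t.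
Proof.
elim: n t => [|n IH] t hs.
  by rewrite expr0 mulr1 qpoch0 mul1r; exact: has_sum_unique.
rewrite exprSr mulrA => ht.
have [u hu] := summationK (abs_summable_euler (x * q ^+ n)).
by rewrite (IH _ hs hu) (euler_sum_qmul hu ht) qpochS mulrA.
Qed.

(** The arguments [x * q ^+ n] tend to 0, and dominated convergence gives the value of Euler's
    series at 0. *)
Lemma euler_sum_cvg1 x (s : nat -> K) :
  (forall n, has_sum (euler_term (x * q ^+ n)) (s n)) -> s n @[n --> \oo] --> (1 : K).
Proof.
move=> hs.
have h0 : has_sum (euler_term 0) 1.
  have -> : (1 : K) = \sum_(i <- [fset 0%N]%fset) euler_term 0 i.
    by rewrite big_seq_fset1 /euler_term !expr0 qpoch0 invr1 !mulr1.
  apply: has_sum_support => -[|a]; rewrite !inE// => _.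
  by rewrite /euler_term expr0n/= mulr0 mul0r.
apply: (has_sum_dominated summationK (abs_summable_euler x) _ _ hs h0).
  move=> n a; apply: euler_term_le.
  by rewrite normrM normrX ler_piMr// exprn_ile1.
move=> a; rewrite /euler_term.
apply: cvgMl; apply: cvgMr.
case: a => [|a].
  by rewrite expr0; under eq_fun do rewrite expr0; exact: cvg_cst.
have -> : (fun n => (x * q ^+ n) ^+ a.+1) = (fun n => x ^+ a.+1 * (q ^+ a.+1) ^+ n).
  by apply/funext => n; rewrite exprMn -!exprM mulnC.
have -> : (0 : K) ^+ a.+1 = x ^+ a.+1 * 0 by rewrite expr0n mulr0.
have qa : `|q ^+ a.+1| < 1 by rewrite normrX; exact: exprn_ilt1.
have h := cvg_expr_complete summationK qa.
by apply: cvgMr; exact: h.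
Qed.

(** Iterating the functional equation writes [qpoch x q n] as the quotient of the Euler sums at [x]
    and at [x * q ^+ n]; the denominator tends to 1. *)
Lemma euler x : qpoch x q n @[n --> \oo] --> qpoch_inf x q /\
  has_sum (euler_term x) (qpoch_inf x q).
Proof.
have [s hs] := choice (fun n =>
  summationK (abs_summable_euler (x * q ^+ n))).
have s1 := euler_sum_cvg1 hs.
have hE : has_sum (euler_term x) (s 0%N) by have := hs 0%N; rewrite expr0 mulr1.
suff h : qpoch x q n @[n --> \oo] --> s 0%N.
  by rewrite /qpoch_inf (cvg_lim _ h)//; split.
have : s 0%N * (s n)^-1 @[n --> \oo] --> s 0%N * 1^-1.
  have s1' := cvgV (oner_neq0 K) s1.
  by apply: cvgMr; exact: s1'.
rewrite invr1 mulr1; apply: cvg_trans; apply: near_eq_cvg.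
(* A value at distance less than 1 from 1 is nonzero, so the division is eventually legitimate. *)
have /cvgrPdist_lt/(_ _ ltr01) := s1.
apply: filterS => n sn.
have sn0 : s n != 0 by apply: contraTneq sn => ->; rewrite subr0 normr1 ltxx.
by rewrite (euler_sum_iter hE (hs n)) mulfK.
Qed.

Lemma qpoch_cvg x : qpoch x q n @[n --> \oo] --> qpoch_inf x q.
Proof. by case: (euler x). Qed.

Lemma euler_sum x : has_sum (euler_term x) (qpoch_inf x q).
Proof. by case: (euler x). Qed.

Arguments qpoch_cvg : clear implicits.
Arguments euler_sum : clear implicits.

Lemma qpoch_inf_split x n : qpoch_inf x q = qpoch x q n * qpoch_inf (x * q ^+ n) q.
Proof. exact: (euler_sum_iter (euler_sum x) (euler_sum (x * q ^+ n))). Qed.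

(** Some tail product is at distance less than 1 from 1, hence nonzero, and the finitely many
    factors before it are nonzero too. *)
Lemma qpoch_inf_neq0 x : (forall n, qpoch x q n != 0) -> qpoch_inf x q != 0.
Proof.
move=> x0.
have /cvgrPdist_lt/(_ _ ltr01) := euler_sum_cvg1 (fun n => euler_sum (x * q ^+ n)).
move=> [n _ /(_ n (leqnn n)) xn]; rewrite (qpoch_inf_split x n) mulf_neq0//.
by apply: contraTneq xn => ->; rewrite subr0 normr1 ltxx.
Qed.

Lemma qpoch_cvgV : [iq n] @[n --> \oo] --> (qpoch_inf q q)^-1.
Proof.
by apply: cvgV (qpoch_cvg q); apply: qpoch_inf_neq0; exact: qpoch_q_neq0.
Qed.

End EulerProduct.

(** * The limiting case of Bailey's lemma *)

Section BaileyLimit.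
Local Open Scope classical_set_scope.
Variable K : numFieldType.
Hypothesis summationK : summation_complete K.
Variable q : K.
Hypothesis q_lt1 : `|q| < 1.

Local Notation "[ 'iq' n ]" := (qpoch q q n)^-1.

Lemma normX_le1 n : `|q ^+ n| <= 1.
Proof. by rewrite normrX exprn_ile1// ltW. Qed.

Lemma norm_expr_le m n : (m <= n)%N -> `|q ^+ n| <= `|q ^+ m|.
Proof.
by move=> mn; rewrite -(subnK mn) exprD normrM ler_piMl// normX_le1.
Qed.

Lemma norm_bailey_alpha k r : `|bailey_alpha q k r| <= 2.
Proof.
case: r => [|r] /=; first by rewrite normr1 ler1n.
rewrite normrM normrN; apply: (@le_trans _ _ (1 * (1 + 1))); last by rewrite mul1r.
apply: ler_pM => //; first exact: normX_le1.
by apply: le_trans (ler_normB _ _) _; rewrite normr1 lerD2l normX_le1.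
Qed.

Lemma qpochV_bounded : exists2 B : K, 0 <= B & forall n, `|[iq n]| <= B.
Proof. exact: (cvgn_norm_bounded (@qpoch_cvgV _ summationK _ q_lt1)). Qed.

Lemma qpoch_bounded : exists2 B : K, 0 <= B & forall n, `|qpoch q q n| <= B.
Proof. exact: (cvgn_norm_bounded (@qpoch_cvg _ summationK _ q_lt1 q)). Qed.

Lemma bailey_beta_bounded k :
  exists2 B : K, 0 <= B & forall n, `|bailey_beta q k n| <= B.
Proof.
have [B B0 hB] := qpochV_bounded.
have [D hD] := abs_summable_geometric q_lt1.
have D0 : 0 <= D by apply: le_trans (hD fset0); rewrite sumr_ge0.
exists (D * B * B); first by rewrite !mulr_ge0.
move=> n; apply: le_trans (ler_norm_sum _ _ _) _.
apply: (@le_trans _ _ (\sum_(0 <= b < n.+1) `|q ^+ b| * B * B)).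
  apply: ler_sum => b _; rewrite !normrM.
  by do 2 apply: ler_pM => //; rewrite ?mulr_ge0.
rewrite -!mulr_suml; do 2 apply: ler_wpM2r => //.
apply: le_trans (hD [fset i in index_iota 0 n.+1]%fset).
rewrite le_eqVlt (@perm_big _ _ _ _ _ [fset i in index_iota 0 n.+1]%fset) ?eqxx//.
apply: uniq_perm; rewrite ?iota_uniq ?fset_uniq// => i.
by rewrite !inE.
Qed.

Lemma has_sum_truncated (f : nat -> K) M :
  has_sum (fun n => if (n <= M)%N then f n else 0) (\sum_(0 <= n < M.+1) f n).
Proof.
have [r [ur rP ->]] : exists r : seq nat, [/\ uniq r,
    forall n, (n \in r) = (n <= M)%N &
    \sum_(0 <= n < M.+1) f n = \sum_(n <- r) f n].
  exists (index_iota 0 M.+1); split; rewrite ?iota_uniq// => n.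
  by rewrite mem_index_iota.
have -> : \sum_(n <- r) f n =
    \sum_(n <- [fset n in r]%fset) (if (n <= M)%N then f n else 0).
  rewrite -[RHS](@perm_big _ _ _ _ r).
    by apply: eq_big_seq => n; rewrite rP => ->.
  by apply: uniq_perm; rewrite ?fset_uniq// => n; rewrite !inE.
by apply: has_sum_support => n; rewrite !inE rP => /negbTE ->.
Qed.

Lemma cvg_truncated (f : nat -> nat -> K) n (l : K) :
  f M n @[M --> \oo] --> l ->
  (if (n <= M)%N then f M n else 0) @[M --> \oo] --> l.
Proof.
apply: cvg_trans; apply: near_eq_cvg; near=> M.
by rewrite ifT//; near: M; exact: nbhs_infty_ge.
Unshelve. all: by end_near. Qed.

Lemma cvg_qpochV_subn n : [iq M - n] @[M --> \oo] --> (qpoch_inf q q)^-1.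
Proof.
have := @qpoch_cvgV _ summationK _ q_lt1; rewrite -(cvg_centern n).
exact.
Qed.

Lemma cvg_qpochV_addn n : [iq M + n] @[M --> \oo] --> (qpoch_inf q q)^-1.
Proof.
have := @qpoch_cvgV _ summationK _ q_lt1; rewrite -(cvg_shiftn n).
exact.
Qed.

Lemma qpoch_inf_q_neq0 : qpoch_inf q q != 0.
Proof. exact/(qpoch_inf_neq0 summationK q_lt1)/(qpoch_q_neq0 q_lt1). Qed.

Lemma leq_muln_addn n k : (n <= n * (n + k))%N.
Proof. by case: n => // n; rewrite leq_pmulr// addSn. Qed.

(** The finite Bailey lemma at [M], multiplied by [qpoch q q M], has two sides equal to [s M]. By
    dominated convergence one tends to [S] and the other to [T] divided by [qpoch_inf q q]. *)
Lemma bailey_limit k (S T : K) :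
  has_sum (fun n => q ^+ (n * (n + k)) * bailey_beta q k n) S ->
  has_sum (fun r => q ^+ (r * (r + k)) * bailey_alpha q k r) T ->
  qpoch_inf q q * S = T.
Proof.
move=> hS hT; have P0 := qpoch_inf_q_neq0.
have [B B0 hB] := qpochV_bounded; have [A A0 hA] := qpoch_bounded.
have [D D0 hD] := bailey_beta_bounded k.
have qP := @qpoch_cvg _ summationK _ q_lt1 q.
pose f M n := qpoch q q M * [iq M - n] * (q ^+ (n * (n + k)) * bailey_beta q k n).
pose g M r := qpoch q q M * [iq M - r] * [iq M + (r + k)] *
  (q ^+ (r * (r + k)) * bailey_alpha q k r).
pose s M := \sum_(0 <= n < M.+1) f M n.
have sE M : s M = \sum_(0 <= r < M.+1) g M r.
  rewrite /s /f; under eq_bigr do rewrite -mulrA [_ * (_ * bailey_beta _ _ _)]mulrA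
    [_ * q ^+ _]mulrC.
  rewrite -mulr_sumr (finite_bailey_lemma (qpoch_q_neq0 q_lt1)) mulr_sumr.
  by apply: eq_bigr => r _; rewrite /g addnA; ring.
have sS : s M @[M --> \oo] --> S.
  have fs M := @has_sum_truncated (f M) M.
  apply: (has_sum_dominated summationK
    (* A geometric majorant suffices because [n <= n * (n + k)]. *)
    (g := fun n => (A * B * D) * q ^+ n) _ _ _ fs hS).
  - exact/abs_summableZ/abs_summable_geometric.
  - move=> M n; rewrite normrM (@ger0_norm _ (A * B * D)) ?mulr_ge0//.
    case: ifP => _; last by rewrite normr0 !mulr_ge0.
    rewrite /f !normrM -[leRHS]mulrA [D * _]mulrC.
    do 2 (apply: ler_pM => //; rewrite ?mulr_ge0//).
    exact: norm_expr_le (leq_muln_addn _ _).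
  - move=> n; apply: (cvg_truncated (f := f)).
    rewrite -[X in _ --> X]mul1r -(divff P0).
    apply: cvgMl; apply: cvgM => //; exact: cvg_qpochV_subn.
have sT : s M @[M --> \oo] --> (qpoch_inf q q)^-1 * T.
  have fs M : has_sum (fun r => if (r <= M)%N then g M r else 0) (s M).
    by rewrite sE; exact: has_sum_truncated.
  apply: (has_sum_dominated summationK
    (g := fun n => (A * B * B * 2) * q ^+ n) _ _ _ fs (has_sumZ hT)).
  - exact/abs_summableZ/abs_summable_geometric.
  - move=> M n; rewrite normrM (@ger0_norm _ (A * B * B * 2)) ?mulr_ge0//.
    case: ifP => _; last by rewrite normr0 !mulr_ge0.
    rewrite /g !normrM -[leRHS]mulrA [2 * _]mulrC.
    apply: ler_pM; rewrite ?mulr_ge0//.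
      by do 2 (apply: ler_pM => //; rewrite ?mulr_ge0//).
    apply: ler_pM => //; last exact: norm_bailey_alpha.
    exact: norm_expr_le (leq_muln_addn _ _).
  - move=> r; apply: (cvg_truncated (f := g)).
    apply: cvgMl; rewrite -[X in _ --> X]mul1r -(divff P0).
    by apply: cvgM (cvg_qpochV_addn _); apply: cvgM => //; exact: cvg_qpochV_subn.
have -> : S = (qpoch_inf q q)^-1 * T by apply: (cvg_unique _ sS sT).
by rewrite mulVKf.
Qed.

Lemma bailey_beta_summable k :
  abs_summable (fun n => q ^+ (n * (n + k)) * bailey_beta q k n).
Proof.
have [D D0 hD] := bailey_beta_bounded k.
apply: abs_summable_le (abs_summableZ D (abs_summable_geometric q_lt1)) => n.
rewrite !normrM (@ger0_norm _ D)// mulrC ler_pM//.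
exact: norm_expr_le (leq_muln_addn _ _).
Qed.

End BaileyLimit.

(** * From the rank function to the Hecke-type double sum *)

Lemma bin2_double n : (2 * 'C(n, 2) + n = n * n)%N.
Proof. by elim: n => // n; rewrite binS bin1; lia. Qed.

Section HeckeExpansion.
Local Open Scope classical_set_scope.
Variable K : numFieldType.
Hypothesis summationK : summation_complete K.
Variables q z : K.
Hypothesis q_lt1 : `|q| < 1.
Hypothesis z_neq0 : z != 0.

Local Notation "[ 'iq' n ]" := (qpoch q q n)^-1.

Definition rank_triple (x : nat * (nat * nat)) : K :=
  q ^+ (x.1 ^ 2)%N * (euler_term q (z * q * q ^+ x.1) x.2.1
                    * euler_term q (z^-1 * q * q ^+ x.1) x.2.2).

(** Since [|q| < 1], the arguments of the two Euler terms have norm at most those of [z] and [z^-1],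
    which decouples the three indices. *)
Lemma rank_triple_summable : abs_summable rank_triple.
Proof.
have := abs_summable_prod (abs_summable_geometric q_lt1)
  (abs_summable_prod (@abs_summable_euler _ summationK _ q_lt1 z)
    (@abs_summable_euler _ summationK _ q_lt1 z^-1)).
apply: abs_summable_le => -[n [a b]]; rewrite /rank_triple /=.
have le_euler w c : `|euler_term q (w * q * q ^+ n) c| <= `|euler_term q w c|.
  apply: euler_term_le; rewrite -mulrA -exprS normrM ler_piMr//.
  exact: normX_le1.
rewrite normrM [leRHS]normrM; apply: ler_pM => //.
  by apply: norm_expr_le => //; rewrite -mulnn; case: (n) => // m; rewrite leq_pmull.
by rewrite normrM [leRHS]normrM; apply: ler_pM; rewrite ?normr_ge0 ?le_euler.
Qed.

Lemma rank_triple_sum_fst s : has_sum rank_triple s ->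
  has_sum (fun n => q ^+ (n ^ 2)%N *
    (qpoch_inf (z * q * q ^+ n) q * qpoch_inf (z^-1 * q * q ^+ n) q)) s.
Proof.
apply: has_sum_fst => n; rewrite /rank_triple /=; apply: has_sumZ.
apply: (@has_sum_prod _ summationK _ _ _ (euler_term q (z^-1 * q * q ^+ n))).
- exact: abs_summable_euler.
- exact: abs_summable_euler.
- exact: (@euler_sum _ summationK _ q_lt1).
- exact: (@euler_sum _ summationK _ q_lt1).
Qed.

(** Here [c] is the smaller Euler index and [k] the difference of the two; the powers [w ^+ c]
    cancel. A general [w] serves both signs of the difference, as [z] or [z^-1]. *)
Lemma rank_triple_diagonal (w : K) m c k : w != 0 ->
  q ^+ (m ^ 2)%N * (euler_term q (w * q * q ^+ m) (c + k)
                  * euler_term q (w^-1 * q * q ^+ m) c) =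
  (-1) ^+ k * w ^+ k * q ^+ 'C(k.+1, 2) *
  (q ^+ ((m + c) * (m + c + k)) * (q ^+ c * [iq c] * [iq (c + k)])).
Proof.
move=> w0; set X := q ^+ 'C(k.+1, 2).
rewrite /euler_term !exprMn exprVn -!exprM !exprD.
have sc : (-1) ^+ c * (-1) ^+ c = 1 :> K by rewrite -expr2 sqrr_sign.
have wc : w ^+ c != 0 by rewrite expf_neq0.
have e : q ^+ (m ^ 2)%N * q ^+ 'C(c + k, 2) * (q ^+ c * q ^+ k) *
    q ^+ (m * (c + k)) * q ^+ 'C(c, 2) * q ^+ c * q ^+ (m * c) =
    X * q ^+ ((m + c) * (m + c + k)) * q ^+ c.
  rewrite /X -!exprD; congr (_ ^+ _).
  have := bin2_double (c + k); have := bin2_double c; have := bin2_double k.+1.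
  by rewrite -mulnn; lia.
transitivity ((-1) ^+ c * (-1) ^+ c * ((-1) ^+ k * w ^+ k) * (w ^+ c / w ^+ c) *
   (q ^+ (m ^ 2)%N * q ^+ 'C(c + k, 2) * (q ^+ c * q ^+ k) *
    q ^+ (m * (c + k)) * q ^+ 'C(c, 2) * q ^+ c * q ^+ (m * c)) *
   ([iq c] * [iq (c + k)])); last first.
  rewrite e sc divff//; move: X (q ^+ ((m + c) * _)) {e} => x y.
  by ring.
move: ((-1) ^+ c) ((-1) ^+ k) (q ^+ 'C(c + k, 2)) (q ^+ 'C(c, 2))
  (q ^+ (m * (c + k))) (q ^+ (m * c)) (q ^+ (m ^ 2)%N) (q ^+ c) (q ^+ k)
  (w ^+ c)^-1 (w ^+ c) (w ^+ k) [iq c] [iq (c + k)] => *.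
by ring.
Qed.

Definition theta_coef (k : int) : K :=
  (-1) ^+ `|k|%N * z ^ k * q ^+ 'C(`|k|.+1, 2).

Definition pos_part (k : int) : nat := if k is Posz n then n else 0%N.
Definition neg_part (k : int) : nat := if k is Negz n then n.+1 else 0%N.

Lemma rank_triple_regroup s : has_sum rank_triple s ->
  has_sum (fun x : int * nat => theta_coef x.1 *
    (q ^+ (x.2 * (x.2 + `|x.1|)) * bailey_beta q `|x.1|%N x.2)) s.
Proof.
move=> hs.
(* The triple [(n, a, b)] goes to [(a - b, n + min(a, b))]; [g] parametrizes the fiber by
   [c = min(a, b)], which runs from 0 to the second component. *)
pose p (x : nat * (nat * nat)) : int * nat :=
  (x.2.1%:Z - x.2.2%:Z, (x.1 + minn x.2.1 x.2.2)%N).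
pose g (x : int * nat) c : nat * (nat * nat) :=
  ((x.2 - c)%N, ((c + pos_part x.1)%N, (c + neg_part x.1)%N)).
pose r (x : int * nat) := [seq g x c | c <- index_iota 0 x.2.+1].
have ur x : uniq (r x).
  rewrite map_inj_uniq ?iota_uniq// => c d [_ /addIn ->]//.
have rP y x : (y \in r x) = (p y == x).
  case: x y => k N [n [a b]]; apply/mapP/eqP => [[c]|[<- <-]].
    rewrite mem_index_iota /= => cN [-> -> ->]; rewrite /p /=.
    by case: k => k /=; congr (_, _); lia.
  exists (minn a b); first by rewrite mem_index_iota /=; lia.
  rewrite /g /= addnK; congr (_, (_, _)).
    by case E : (a%:Z - b%:Z) => [m|m] /=; lia.
  by case E : (a%:Z - b%:Z) => [m|m] /=; lia.
have := has_sum_fibers ur rP hs.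
suff h x : \sum_(i <- r x) rank_triple i = theta_coef x.1 *
    (q ^+ (x.2 * (x.2 + `|x.1|)) * bailey_beta q `|x.1|%N x.2).
  by under eq_fun do rewrite h.
case: x => k N; rewrite /r big_map /= /bailey_beta !mulr_sumr.
apply: eq_big_nat => c /andP[_ cN]; rewrite /rank_triple /=.
have [m ->] : exists m, N = (m + c)%N by exists (N - c)%N; rewrite subnK.
rewrite addnK /theta_coef; case: k => k /=.
  by rewrite addn0 rank_triple_diagonal.
(* For negative [k] the two Euler factors exchange roles. *)
have := rank_triple_diagonal m c k.+1 (invr_neq0 z_neq0).
rewrite invrK [euler_term _ (z * _ * _) _ * _]mulrC addn0 => ->.
by rewrite exprVn.
Qed.

Definition hecke_double (x : int * nat) : K :=
  theta_coef x.1 * (q ^+ (x.2 * (x.2 + `|x.1|)) * bailey_alpha q `|x.1|%N x.2).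

(** The terms of [hecke_double] from the [a q^(2r)] half of [alpha_r] for [r > 0], together with
    those from [alpha_0 = 1]. *)
Definition hecke_plus (x : int * nat) : K :=
  (-1) ^+ `|x.1|%N * z ^ x.1 *
  q ^+ (3 * x.2 * x.2 + 3 * x.2 * `|x.1| + x.2 + 'C(`|x.1|.+1, 2)).

(* Here [x.2 = j - 1], so that the exponent is
   [3 j^2 + 3 j |k| - j + |k| (|k| - 1) / 2]. *)
Definition hecke_minus (x : int * nat) : K :=
  - ((-1) ^+ `|x.1|%N * z ^ x.1 *
  q ^+ ((3 * x.2 + 2) * x.2.+1 + 3 * x.2.+1 * `|x.1| + 'C(`|x.1|, 2))).

Lemma hecke_double_split x : hecke_double x =
  hecke_plus x + (if x.2 is j.+1 then hecke_minus (x.1, j) else 0).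
Proof.
case: x => k [|j]; rewrite /hecke_double /hecke_plus /hecke_minus /theta_coef /=.
  rewrite addr0 mul0n expr0 !mulr1; congr (_ * _ ^+ _); lia.
rewrite !mulrA mulrBr mulr1 mulrN addrC mulNr opprK.
congr (_ + _); last first.
  congr (- _); rewrite -!mulrA -!exprD; congr (_ * (_ * _ ^+ _)).
  by rewrite binS bin1; lia.
rewrite -!mulrA -!exprD; congr (_ * (_ * _ ^+ _)); lia.
Qed.

(** Both signs of [k] are covered by the majorant with base [|z| + |z^-1|]. *)
Lemma zpower_superexp_summable :
  abs_summable (fun k : int => z ^ k * q ^+ 'C(`|k|, 2)).
Proof.
have q01 : 0 <= `|q| < 1 by rewrite normr_ge0.
have y0 : 0 <= `|z| + `|z^-1| by rewrite addr_ge0.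
have := abs_summable_absz (abs_summable_superexp summationK q01 y0).
apply: abs_summable_le => k; rewrite [leRHS]ger0_norm ?mulr_ge0 ?exprn_ge0//.
rewrite normrM normrX ler_wpM2r ?exprn_ge0//; case: k => k.
  by rewrite normrX lerXn2r ?nnegrE// lerDl.
by rewrite -[z ^ _]/(z ^- k.+1) -exprVn normrX lerXn2r ?nnegrE// lerDr.
Qed.

Lemma hecke_plus_summable : abs_summable hecke_plus.
Proof.
have := abs_summable_prod zpower_superexp_summable (abs_summable_geometric q_lt1).
apply: abs_summable_le => -[k j] /=; rewrite /hecke_plus /=.
rewrite !normrM normrX normrN1 expr1n mul1r -[leRHS]mulrA
  -[X in _ <= _ * X]normrM -exprD ler_wpM2l//.
by apply: norm_expr_le => //; rewrite binS bin1; lia.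
Qed.

Lemma hecke_minus_summable : abs_summable hecke_minus.
Proof.
have := abs_summable_prod zpower_superexp_summable (abs_summable_geometric q_lt1).
apply: abs_summable_le => -[k j] /=; rewrite /hecke_minus /=.
rewrite normrN !normrM normrX normrN1 expr1n mul1r -[leRHS]mulrA
  -[X in _ <= _ * X]normrM -exprD ler_wpM2l//.
by apply: norm_expr_le => //; lia.
Qed.

(** For fixed [k], [bailey_limit] relates the inner sums of the two double families, so
    [qpoch_inf q q * s] and [sp + sm] are sums of one family indexed by [k]. *)
Lemma rank_hecke s sp sm : has_sum rank_triple s ->
  has_sum hecke_plus sp -> has_sum hecke_minus sm ->
  qpoch_inf q q * s = sp + sm.
Proof.
move=> hs hp hm.
have hd : has_sum hecke_double (sp + sm).
  have -> : hecke_double = fun x => hecke_plus x +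
      (if x.2 is j.+1 then hecke_minus (x.1, j) else 0).
    by apply/funext => x; exact: hecke_double_split.
  apply: has_sumD hp _.
  (* The minus half starts at [r = 1], so it enters shifted by one and extended by zero. *)
  apply: (@has_sum_embed _ _ _ (fun x : int * nat => (x.1, x.2.+1))
    (fun x => (x.1, x.2.-1))).
  - by case.
  - by case=> k [|j]//=; rewrite eqxx.
  - by rewrite (_ : _ \o _ = hecke_minus)//; apply/funext => -[k j].
have hr := rank_triple_regroup hs.
have [S hS] := choice (fun k => summationK (bailey_beta_summable summationK q_lt1 k)).
have h1 : has_sum (fun k : int => theta_coef k * S `|k|%N) s.
  by apply: has_sum_fst hr => k; exact: has_sumZ (hS _).
have alpha_summable k : abs_summable (fun r => q ^+ (r * (r + k)) * bailey_alpha q k r).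
  apply: abs_summable_le (abs_summableZ 2 (abs_summable_geometric q_lt1)) => n.
  rewrite !normrM (@ger0_norm _ 2)// mulrC ler_pM ?norm_bailey_alpha//.
  exact: norm_expr_le (leq_muln_addn _ _).
have h2 : has_sum (fun k : int => theta_coef k * (qpoch_inf q q * S `|k|%N)) (sp + sm).
  apply: has_sum_fst hd => k; apply: has_sumZ.
  have [T hT] := summationK (alpha_summable `|k|%N).
  by rewrite (bailey_limit summationK q_lt1 (hS _) hT).
have h3 := has_sumZ (c := qpoch_inf q q) h1.
apply: has_sum_unique h3 _; move: h2.
by under eq_fun do rewrite mulrCA.
Qed.

End HeckeExpansion.

(** * Regrouping the double sum *)

Section Regrouping.
Local Open Scope classical_set_scope.
Variable K : numFieldType.
Variables q z : K.

(** The hypothesis states that [e] is half the dividend, without subtraction, and so removes the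
    integer division. *)
Lemma expo_minusE n j e : (n * n + n = 2 * e + (3 * j * j + j))%N ->
  expo_minus n j = e%:Z.
Proof.
move=> h; rewrite /expo_minus.
have -> : n%:Z ^+ 2 - 3 * j%:Z ^+ 2 + (n%:Z - j%:Z) = e%:Z * 2 by rewrite !expr2; lia.
by rewrite mulzK.
Qed.

Lemma expo_plusE n j e : (n * n + n + j = 2 * e + 3 * j * j)%N ->
  expo_plus n j = e%:Z.
Proof.
move=> h; rewrite /expo_plus.
have -> : n%:Z ^+ 2 - 3 * j%:Z ^+ 2 + (n%:Z + j%:Z) = e%:Z * 2 by rewrite !expr2; lia.
by rewrite mulzK.
Qed.

Lemma sign_parity m n : odd m = odd n -> (-1) ^+ m = (-1) ^+ n :> K.
Proof. by move=> h; rewrite -(signr_odd _ m) h signr_odd. Qed.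

(* For [k < 0] the pair [(k, i)] of the double sum is the summand
   [j = i + |k|] of the inner Hecke sum. *)
Lemma hecke_plusE n j (k : int) i : k = n%:Z - 3 * j%:Z ->
  (j = i + neg_part k)%N ->
  (-1) ^+ (n + j) * z ^ (n%:Z - 3 * j%:Z) * q ^ expo_minus n j
  = hecke_plus q z (k, i).
Proof.
move=> kE jE; rewrite /hecke_plus -kE /=.
congr (_ * _ * _); first by apply: sign_parity; lia.
rewrite (@expo_minusE n j (3 * i * i + 3 * i * `|k|%N + i + 'C(`|k|%N.+1, 2)))//.
have := bin2_double `|k|%N.+1.
by case: k kE jE => k /= kE jE; nia.
Qed.

Lemma hecke_minusE n j (k : int) i : k = n%:Z - 3 * j%:Z + 1 ->
  (j = i.+1 + neg_part k)%N ->
  (-1) ^+ (n + j) * z ^ (n%:Z - 3 * j%:Z + 1) * q ^ expo_plus n j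
  = hecke_minus q z (k, i).
Proof.
move=> kE jE; rewrite /hecke_minus -kE /= -!mulNr.
congr (_ * _ * _).
  (* The shift by one in [k = n - 3 j + 1] accounts for the minus sign. *)
  by rewrite -[RHS]mulN1r -exprS; apply: sign_parity; lia.
rewrite (@expo_plusE n j ((3 * i + 2) * i.+1 + 3 * i.+1 * `|k|%N + 'C(`|k|%N, 2)))//.
have := bin2_double `|k|%N.
by case: k kE jE => k /= kE jE; nia.
Qed.

(** The pairs with [k >= 0] give [j <= n / 3] and [i = j]; those with [k < 0] give [j > n / 3] and
    [i = n - 2 j], so that [i >= 0] is exactly the bound [j <= n / 2]. *)
Lemma hecke_term_plus s : has_sum (hecke_plus q z) s ->
  has_sum (fun n => \sum_(0 <= j < n./2.+1)
     (-1) ^+ (n + j) * z ^ (n%:Z - 3 * j%:Z) * q ^ expo_minus n j) s.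
Proof.
move=> hs.
pose p (x : int * nat) := (3 * x.2 + `|x.1| + neg_part x.1)%N.
pose g n j : int * nat :=
  (n%:Z - 3 * j%:Z, if (3 * j <= n)%N then j else (n - 2 * j)%N).
pose r n := [seq g n j | j <- index_iota 0 n./2.+1].
have ur n : uniq (r n).
  by rewrite map_inj_uniq ?iota_uniq// => i j []; lia.
have rP x n : (x \in r n) = (p x == n).
  case: x => k i; apply/mapP/eqP => [[j]|].
    rewrite mem_index_iota /= => jn []; rewrite /p /=.
    by case: ifP => jn' kE ->; case: k kE => k /= kE; lia.
  rewrite /p /= => nE; exists (i + neg_part k)%N.
    by rewrite mem_index_iota /=; case: k nE => k /= nE; lia.
  by rewrite /g; case: k nE => k /= nE; case: ifP => nj; congr (_, _); lia.
have := has_sum_fibers ur rP hs; rewrite /r.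
suff h n : \sum_(i <- [seq g n j | j <- index_iota 0 n./2.+1]) hecke_plus q z i =
    \sum_(0 <= j < n./2.+1)
     (-1) ^+ (n + j) * z ^ (n%:Z - 3 * j%:Z) * q ^ expo_minus n j.
  by under eq_fun do rewrite h.
rewrite big_map; apply: eq_big_nat => j /andP[_ jn].
rewrite /g; symmetry; apply: hecke_plusE => //; case: ifP => jn'.
  by case E : (n%:Z - 3 * j%:Z) => [k|k] /=; lia.
by case E : (n%:Z - 3 * j%:Z) => [k|k] /=; lia.
Qed.

(** Same bijection with [k = n - 3 j + 1]: now [i = j - 1] for [k >= 0] and [i = n - 2 j] for
    [k < 0]. *)
Lemma hecke_term_minus s : has_sum (hecke_minus q z) s ->
  has_sum (fun n => \sum_(1 <= j < n./2.+1)
     (-1) ^+ (n + j) * z ^ (n%:Z - 3 * j%:Z + 1) * q ^ expo_plus n j) s.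
Proof.
move=> hs.
pose p (x : int * nat) := (3 * x.2 + 2 + `|x.1| + neg_part x.1)%N.
pose g n j : int * nat :=
  (n%:Z - 3 * j%:Z + 1, if (3 * j <= n.+1)%N then j.-1 else (n - 2 * j)%N).
pose r n := [seq g n j | j <- index_iota 1 n./2.+1].
have ur n : uniq (r n).
  by rewrite map_inj_uniq ?iota_uniq// => i j []; lia.
have rP x n : (x \in r n) = (p x == n).
  case: x => k i; apply/mapP/eqP => [[j]|].
    rewrite mem_index_iota /= => jn []; rewrite /p /=.
    by case: ifP => jn' kE ->; case: k kE => k /= kE; lia.
  rewrite /p /= => nE; exists (i.+1 + neg_part k)%N.
    by rewrite mem_index_iota /=; case: k nE => k /= nE; lia.
  by rewrite /g; case: k nE => k /= nE; case: ifP => nj; congr (_, _); lia.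
have := has_sum_fibers ur rP hs; rewrite /r.
suff h n : \sum_(i <- [seq g n j | j <- index_iota 1 n./2.+1]) hecke_minus q z i =
    \sum_(1 <= j < n./2.+1)
     (-1) ^+ (n + j) * z ^ (n%:Z - 3 * j%:Z + 1) * q ^ expo_plus n j.
  by under eq_fun do rewrite h.
rewrite big_map; apply: eq_big_nat => j jn.
rewrite /g; symmetry; apply: hecke_minusE => //; case: ifP => jn'.
  by case E : (n%:Z - 3 * j%:Z + 1) => [k|k] /=; lia.
by case E : (n%:Z - 3 * j%:Z + 1) => [k|k] /=; lia.
Qed.

Lemma hecke_term_sum sp sm : has_sum (hecke_plus q z) sp ->
  has_sum (hecke_minus q z) sm -> has_sum (hecke_term z q) (sp + sm).
Proof.
by move=> hp hm; apply: has_sumD; [exact: hecke_term_plus | exact: hecke_term_minus].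
Qed.

(** The symmetric form pairs [k] with [-k]; the terms with [k = 0] become the diagonal series. *)
Lemma has_sum_sign_split (f : int * nat -> K) s s1 s2 s3 : has_sum f s ->
  has_sum (fun x : nat * nat => f (Posz x.1.+1, x.2)) s1 ->
  has_sum (fun x : nat * nat => f (Negz x.1, x.2)) s2 ->
  has_sum (fun j => f (0, j)) s3 -> s = s1 + s2 + s3.
Proof.
move=> hs h1 h2 h3.
have h1' : has_sum (fun x => if x.1 is Posz _.+1 then f x else 0) s1.
  apply: (@has_sum_embed _ _ _ (fun x : nat * nat => (Posz x.1.+1, x.2))
    (fun x => (`|x.1|.-1, x.2))%N) => //; first by case.
  by case=> -[[|k]|k] j //=; rewrite eqxx.
have h2' : has_sum (fun x => if x.1 is Negz _ then f x else 0) s2.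
  apply: (@has_sum_embed _ _ _ (fun x : nat * nat => (Negz x.1, x.2))
    (fun x => (`|x.1|.-1, x.2))%N) => //; first by case.
  by case=> -[[|k]|k] j //=; rewrite eqxx.
have h3' : has_sum (fun x => if x.1 is Posz 0 then f x else 0) s3.
  apply: (@has_sum_embed _ _ _ (fun j => (0 : int, j)) snd) => //.
  by case=> -[[|k]|k] j //=; rewrite eqxx.
apply: has_sum_unique hs _.
have := has_sumD (has_sumD h1' h2') h3'.
rewrite (_ : (fun i => _) = f)//; apply/funext => -[[[|k]|k] j] /=; ring.
Qed.

(** The name refers to the sign in the exponent's [n - j], so this series regroups [hecke_plus]. The
    indices [k] and [-k] share sign and power of [q], with [n = 3 j + |k|] and [|k| = x.1 + 1] in
    both families. *)
Lemma sym_term_minus_sum s1 s2 :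
  has_sum (fun x : nat * nat => hecke_plus q z (Posz x.1.+1, x.2)) s1 ->
  has_sum (fun x : nat * nat => hecke_plus q z (Negz x.1, x.2)) s2 ->
  has_sum (sym_term_minus z q) (s1 + s2).
Proof.
move=> h1 h2.
pose p (x : nat * nat) := (3 * x.2 + x.1.+1)%N.
pose g n j : nat * nat := ((n - 3 * j).-1, j).
pose r n := [seq g n j | j <- [seq j <- index_iota 0 n | (3 * j < n)%N]].
have ur n : uniq (r n).
  by rewrite map_inj_uniq ?filter_uniq ?iota_uniq// => i j [].
have rP x n : (x \in r n) = (p x == n).
  case: x => k i; apply/mapP/eqP => [[j]|].
    by rewrite mem_filter mem_index_iota /p /= => jn [-> ->]; lia.
  rewrite /p /= => nE; exists i; first by rewrite mem_filter mem_index_iota /=; lia.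
  by rewrite /g; congr (_, _); lia.
have := has_sumD (has_sum_fibers ur rP h1) (has_sum_fibers ur rP h2).
rewrite /r (_ : (fun n => _) = sym_term_minus z q)//; apply/funext => n.
rewrite -big_split /= big_map big_filter; apply: eq_bigr => j jn.
have -> : 3 * j%:Z - n%:Z = Negz (n - 3 * j).-1 by lia.
have -> : n%:Z - 3 * j%:Z = Posz (n - 3 * j).-1.+1 by lia.
rewrite /hecke_plus /= mulrDr mulrDl.
have -> : (-1) ^+ (n + j) = (-1) ^+ (n - 3 * j).-1.+1 :> K.
  by apply: sign_parity; lia.
set k := (n - 3 * j).-1.+1.
rewrite (@expo_minusE n j (3 * j * j + 3 * j * k + j + 'C(k.+1, 2)))//.
by have := bin2_double k.+1; rewrite /k => h; nia.
Qed.

(** Here [|k| = n - 3 j + 1] and the second index is [j - 1], whence [n = 3 x.2 + x.1 + 3]. *)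
Lemma sym_term_plus_sum s1 s2 :
  has_sum (fun x : nat * nat => hecke_minus q z (Posz x.1.+1, x.2)) s1 ->
  has_sum (fun x : nat * nat => hecke_minus q z (Negz x.1, x.2)) s2 ->
  has_sum (sym_term_plus z q) (s1 + s2).
Proof.
move=> h1 h2.
pose p (x : nat * nat) := (3 * x.2 + x.1 + 3)%N.
pose g n j : nat * nat := ((n - 3 * j)%N, j.-1).
pose r n := [seq g n j | j <- [seq j <- index_iota 1 n.+1 | (3 * j < n + 1)%N]].
have ur n : uniq (r n).
  rewrite map_inj_in_uniq ?filter_uniq ?iota_uniq// => i j.
  by rewrite !mem_filter !mem_index_iota => ? ? []; lia.
have rP x n : (x \in r n) = (p x == n).
  case: x => k i; apply/mapP/eqP => [[j]|].
    by rewrite mem_filter mem_index_iota /p /= => jn [-> ->]; lia.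
  rewrite /p /= => nE; exists i.+1.
    by rewrite mem_filter mem_index_iota /=; lia.
  by rewrite /g; congr (_, _); lia.
have := has_sumD (has_sum_fibers ur rP h1) (has_sum_fibers ur rP h2).
rewrite /r (_ : (fun n => _) = sym_term_plus z q)//; apply/funext => n.
rewrite -big_split /= big_map big_filter /sym_term_plus big_nat_cond [RHS]big_nat_cond.
apply: eq_bigr => -[//|j] /andP[_ jn].
have -> : 3 * j.+1%:Z - n%:Z - 1 = Negz (n - 3 * j.+1) by lia.
have -> : n%:Z - 3 * j.+1%:Z + 1 = Posz (n - 3 * j.+1).+1 by lia.
rewrite /hecke_minus /= mulrDr mulrDl -!mulNr.
have -> : (-1) ^+ (n + j.+1) = - (-1) ^+ (n - 3 * j.+1).+1 :> K.
  by rewrite -[RHS]mulN1r -exprS; apply: sign_parity; lia.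
set k := (n - 3 * j.+1).+1.
rewrite (@expo_plusE n j.+1 ((3 * j + 2) * j.+1 + 3 * j.+1 * k + 'C(k, 2)))//.
by have := bin2_double k; rewrite /k => h; nia.
Qed.

Lemma diag_term_plusE j : hecke_plus q z (0, j) = diag_term_plus q j.
Proof.
rewrite /hecke_plus /diag_term_plus /= !mul1r.
rewrite (_ : 3 * _ + _ = (3 * j * j + 3 * j * 0 + j + 'C(1, 2))%N%:Z)//.
by rewrite expr2 (_ : 'C(1, 2) = 0%N)//; lia.
Qed.

Lemma diag_term_minusE j : hecke_minus q z (0, j) = - diag_term_minus q j.+1.
Proof.
rewrite /hecke_minus /diag_term_minus /= !mul1r; congr (- _).
rewrite (_ : 3 * _ - _ = ((3 * j + 2) * j.+1 + 3 * j.+1 * 0 + 'C(0, 2))%N%:Z)//.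
by rewrite expr2 (_ : 'C(0, 2) = 0%N)//; lia.
Qed.

End Regrouping.

(** * Assembling the identity *)

Lemma has_sum_infsum (K : numFieldType) m (u : nat -> K) s :
  has_sum (fun n => if (m <= n)%N then u n else 0) s ->
  infsum_cvg m u /\ infsum m u = s.
Proof.
move=> /has_sum_psum us; split; first by apply/cvg_ex; exists s.
by rewrite /infsum; apply: cvg_lim us.
Qed.

Lemma rank_hecke_identity (K : numFieldType) (summationK : summation_complete K)
  (q z : K) (hq : 0 < `|q| < 1) (hz0 : z != 0)
  (hz : forall m : int, m != 0 -> z != q ^ m) :
  [/\ qpoch_inf_cvg (z * q) q, qpoch_inf_cvg (z^-1 * q) q,
      qpoch_inf_cvg q q & infsum_cvg 0 (rank_term z q)] /\
  [/\ infsum_cvg 0 (hecke_term z q),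
      infsum_cvg 0 (sym_term_minus z q), infsum_cvg 0 (diag_term_plus q),
      infsum_cvg 0 (sym_term_plus z q) & infsum_cvg 1 (diag_term_minus q)] /\
  qpoch_inf (z * q) q * qpoch_inf (z^-1 * q) q * qpoch_inf q q * dyson_rank z q
    = infsum 0 (hecke_term z q) /\
  infsum 0 (hecke_term z q)
    = infsum 0 (sym_term_minus z q) + infsum 0 (diag_term_plus q)
      + infsum 0 (sym_term_plus z q) - infsum 1 (diag_term_minus q).
Proof.
have /andP[q_gt0 q1] := hq.
have q0 : q != 0 by rewrite -normr_gt0.
have qcvg x : qpoch_inf_cvg x q.
  by apply/cvg_ex; exists (qpoch_inf x q); exact: (@qpoch_cvg _ summationK _ q1).
(* A vanishing factor would make [w] a negative power of [q]; for [w = z] and [w = z^-1] this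
   excludes the negative and the positive exponents of the hypothesis on [z]. *)
have poch_neq0 (w : K) : (forall i, w != q ^- i.+1) -> forall n, qpoch (w * q) q n != 0.
  move=> hw n; rewrite /qpoch prodf_seq_neq0; apply/allP => i _ /=.
  rewrite -mulrA -exprS subr_eq0; apply: contra (hw i) => /eqP w1.
  by rewrite -[_^-1]mul1r w1 mulfK// expf_neq0.
have zq := poch_neq0 z (fun i => hz (Negz i) isT).
have zVq : forall n, qpoch (z^-1 * q) q n != 0.
  apply: poch_neq0 => i; rewrite (inj_eq invr_inj).
  exact: (hz (Posz i.+1) isT).
have [s hs] := summationK _ _ (rank_triple_summable summationK z q1).
have A0 := qpoch_inf_neq0 summationK q1 zq.
have B0 := qpoch_inf_neq0 summationK q1 zVq.
have [rank_cvg rankE] : infsum_cvg 0 (rank_term z q) /\ infsum 0 (rank_term z q) =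
    (qpoch_inf (z * q) q * qpoch_inf (z^-1 * q) q)^-1 * s.
  apply: has_sum_infsum.
  have := has_sumZ (c := (qpoch_inf (z * q) q * qpoch_inf (z^-1 * q) q)^-1)
    (rank_triple_sum_fst summationK q1 hs).
  suff h n : (qpoch_inf (z * q) q * qpoch_inf (z^-1 * q) q)^-1 *
      (q ^+ (n ^ 2)%N * (qpoch_inf (z * q * q ^+ n) q * qpoch_inf (z^-1 * q * q ^+ n) q))
      = rank_term z q n.
    by under eq_fun do rewrite h.
  (* Splitting off the first [n] factors of each infinite product cancels the tails and leaves the
     rank term. *)
  have Az := @qpoch_inf_split _ summationK _ q1 (z * q) n.
  have Bz := @qpoch_inf_split _ summationK _ q1 (z^-1 * q) n.
  move: A0 B0; rewrite /rank_term Az Bz !mulf_eq0 !negb_or.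
  move=> /andP[? ?] /andP[? ?].
  by field; do !(apply/andP; split).
have ps := hecke_plus_summable summationK q1 hz0.
have ms := hecke_minus_summable summationK q1 hz0.
have [sp hp] := summationK _ _ ps.
have [sm hm] := summationK _ _ ms.
have [hecke_cvg heckeE] := @has_sum_infsum _ 0 _ _ (hecke_term_sum hp hm).
have posI : injective (fun x : nat * nat => (Posz x.1.+1, x.2)) by move=> [? ?] [? ?] [-> ->].
have negI : injective (fun x : nat * nat => (Negz x.1, x.2)) by move=> [? ?] [? ?] [-> ->].
have zeroI : injective (fun j : nat => (0 : int, j)) by move=> ? ? [].
have [sp1 hp1] := summationK _ _ (abs_summable_inj posI ps).
have [sp2 hp2] := summationK _ _ (abs_summable_inj negI ps).
have [sp3 hp3] := summationK _ _ (abs_summable_inj zeroI ps).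
have [sm1 hm1] := summationK _ _ (abs_summable_inj posI ms).
have [sm2 hm2] := summationK _ _ (abs_summable_inj negI ms).
have [sm3 hm3] := summationK _ _ (abs_summable_inj zeroI ms).
have [symm_cvg symmE] := @has_sum_infsum _ 0 _ _ (sym_term_minus_sum hp1 hp2).
have [symp_cvg sympE] := @has_sum_infsum _ 0 _ _ (sym_term_plus_sum hm1 hm2).
have [diagp_cvg diagpE] : infsum_cvg 0 (diag_term_plus q) /\
    infsum 0 (diag_term_plus q) = sp3.
  apply: has_sum_infsum; move: hp3; rewrite /comp.
  by under eq_fun do rewrite diag_term_plusE.
have [diagm_cvg diagmE] : infsum_cvg 1 (diag_term_minus q) /\
    infsum 1 (diag_term_minus q) = - sm3.
  apply: has_sum_infsum.
  (* This series starts at [j = 1], while the second index of [hecke_minus] is [j - 1]. *)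
  apply: (@has_sum_embed _ _ _ succn predn) => //.
    by case=> [|n]//=; rewrite eqxx.
  have := has_sumZ (c := -1) hm3; rewrite mulN1r /comp.
  by under eq_fun do rewrite diag_term_minusE mulN1r opprK.
split; first by split.
split; first by split.
rewrite /dyson_rank rankE heckeE symmE sympE diagpE diagmE opprK.
have spE := has_sum_sign_split hp hp1 hp2 hp3.
have smE := has_sum_sign_split hm hm1 hm2 hm3.
split; last by rewrite spE smE; ring.
rewrite -(rank_hecke summationK q1 hz0 hs hp hm).
by field; apply/andP; split.
Qed.

Theorem theorem1p1 (R : realType) (q z : R[i])
  (hq : 0 < `|q| < 1) (hz0 : z != 0)
  (hz : forall m : int, m != 0 -> z != q ^ m) :
  [/\ qpoch_inf_cvg (z * q) q, qpoch_inf_cvg (z^-1 * q) q,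
      qpoch_inf_cvg q q & infsum_cvg 0 (rank_term z q)] /\
  [/\ infsum_cvg 0 (hecke_term z q),
      infsum_cvg 0 (sym_term_minus z q), infsum_cvg 0 (diag_term_plus q),
      infsum_cvg 0 (sym_term_plus z q) & infsum_cvg 1 (diag_term_minus q)] /\
  qpoch_inf (z * q) q * qpoch_inf (z^-1 * q) q * qpoch_inf q q * dyson_rank z q
    = infsum 0 (hecke_term z q) /\
  infsum 0 (hecke_term z q)
    = infsum 0 (sym_term_minus z q) + infsum 0 (diag_term_plus q)
      + infsum 0 (sym_term_plus z q) - infsum 1 (diag_term_minus q).
Proof.
exact: rank_hecke_identity (@complex_summation_complete R) _ _ hq hz0 hz.
Qed.
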